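(* Let $\mathfrak T=(n_1,\dots,n_t)$ be a tower type of degree $n$. Suppose one of the following holds: (1) $n<8$; (2) $n=8$ and $\mathfrak T\ne(8)$; (3) $n$ is prime; (4) $\mathfrak T=(p,\dots,p)$ for a prime $p$; (5) $\mathfrak T=(2,p)$ for a prime $p$; (6) $\mathfrak T=(3,p)$ for a prime $p$. Then for all integers $i,j$ with $0\le i,j$ and $i+j<n$, the following are equivalent: (a) there exists a constant $c_{\mathfrak T}>0$ depending only on $\mathfrak T$ such that $\lambda_{i+j}(\mathcal O)\le c_{\mathfrak T}\lambda_i(\mathcal O)\lambda_j(\mathcal O)$ for all $\mathcal O\in\mathcal S(\mathfrak T)$; (b) the addition $i+j$ does not overflow modulo $\mathfrak T$.
   Context: For a number field of degree $n$ with complex embeddings $\sigma_1,\dots,\sigma_n$, $|x|=\sqrt{\frac1n\sum_m|\sigma_m(x)|^2}$; for a full rank lattice $\Lambda$, $\lambda_i(\Lambda)=\min\{r>0:\dim_{\mathbb Q}\mathrm{Span}_{\mathbb Q}\{x\in\Lambda:|x|\le r\}\ge i+1\}$. A tower type is a tuple $(n_1,\dots,n_t)$ of integers $>1$, with degree $\prod n_s$. The tower type of a tower $\mathbb Q=K_0\subset\dots\subset K_t$ (no trivial extensions) is $([K_1:K_0],\dots,[K_t:K_{t-1}])$. The tower type of an order $\mathcal O$ in a number field is the tower type of the tower of those fields $L$ such that $L=\mathbb Q(\{x\in\mathcal O:|x|\le r\})$ for some $r>0$. $\mathcal S(\mathfrak T)$ is the set of isomorphism classes of orders (in degree $n$ number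 fields) with tower type $\mathfrak T$. Writing $m=m_1+m_2n_1+\dots+m_tn_1\cdots n_{t-1}$ with $0\le m_s<n_s$ (mixed radix), the addition $i+j=k$ does not overflow modulo $\mathfrak T$ if $i_s+j_s=k_s$ for all $s$. *)

(* Defs.v *)
From HB Require Import structures.
From mathcomp Require Import all_boot all_order all_algebra all_field.
From mathcomp Require Import all_classical reals.
From mathcomp Require Import complex.
Set Implicit Arguments.
Unset Strict Implicit.
Unset Printing Implicit Defensive.
Import Order.TTheory GRing.Theory Num.Theory.
Local Open Scope ring_scope.
Local Open Scope classical_set_scope.

(* Towers, and addition in mixed radix. *)

(* A tower type (n_1, ..., n_t) is the sequence [:: n_1; ...; n_t]; the
   0-indexed entry T`_s is n_(s+1). *)
Definition is_tower_type (T : seq nat) : bool := all (fun m => 1 < m)%N T.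

Definition tower_degree (T : seq nat) : nat := (\prod_(m <- T) m)%N.

Definition mixed_radix (T : seq nat) (m : nat) (d : seq nat) : Prop :=
  [/\ size d = size T,
      forall s, (s < size T)%N -> (nth 0 d s < nth 0 T s)%N
    & m = (\sum_(s < size T) nth 0 d s * tower_degree (take s T))%N].

Definition no_overflow (T : seq nat) (i j : nat) : Prop :=
  exists di dj dk : seq nat,
    [/\ mixed_radix T i di, mixed_radix T j dj, mixed_radix T (i + j) dk
      & forall s, (s < size T)%N -> (nth 0 di s + nth 0 dj s = nth 0 dk s)%N].

Section NumberField.

Variables (R : realType) (L : fieldExtType rat).

Definition degree : nat := \dim {:L}.

Definition embeddings : set (L -> R[i]) :=
  [set s : L -> R[i] | exists f : {rmorphism L -> R[i]}, s = f].

(* [embeddings] is finite, so the finitely supported sum below is the sum over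
   all complex embeddings. *)
Definition absL (x : L) : R :=
  Num.sqrt (degree%:R^-1 *
    \sum_(s \in embeddings) ComplexField.Normc.normc (s x) ^+ 2).

Definition is_Qspan (A : set L) (U : {vspace L}) : Prop :=
  (forall x, A x -> x \in U) /\
  (forall V : {vspace L}, (forall x, A x -> x \in V) -> (U <= V)%VS).

Definition Qspan (A : set L) : {vspace L} := xget 0%VS [set U | is_Qspan A U].

(* Q(A): as L is algebraic over Q, this is the Q-algebra generated by A. *)
Definition Qadjoin (A : set L) : {subfield L} := <<Qspan A>>%AS.

Definition is_order (O : {pred L}) : Prop :=
  subring_closed O /\
  exists b : degree.-tuple L,
    basis_of {:L} b /\ (forall x, x \in O <-> inIntSpan b x).

Definition short (O : {pred L}) (r : R) : set L :=
  [set x | x \in O /\ absL x <= r].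

Definition minimum (S : set R) : R := xget 0 [set r | S r /\ lbound S r].

Definition lambda (O : {pred L}) (i : nat) : R :=
  minimum [set r | 0 < r /\ (i.+1 <= \dim (Qspan (short O r)))%N].

(* Ks lists K_1, ..., K_t; the field K_0 is Q, that is 1%AS. *)
Definition is_tower (Ks : seq {subfield L}) : bool :=
  path (fun K E : {subfield L} => (K <= E)%VS && (K != E)) 1%AS Ks.

Definition tower_type (Ks : seq {subfield L}) : seq nat :=
  pairmap (fun K E : {subfield L} => \dim_K E) 1%AS Ks.

Definition has_tower_type (O : {pred L}) (T : seq nat) : Prop :=
  exists Ks : seq {subfield L},
    [/\ is_tower Ks,
        forall K : {subfield L}, K \in (1%AS : {subfield L}) :: Ks <->
          exists2 r : R, 0 < r & K = Qadjoin (short O r)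
      & T = tower_type Ks].

Lemma QspanP (A : set L) : is_Qspan A (Qspan A).
Proof.
rewrite /Qspan; apply: (@xgetPex _ 0%VS [set U | is_Qspan A U]).
pose P m := `[< exists2 X : seq L, (forall x, x \in X -> A x) & \dim <<X>> = m >].
have exP : exists m, P m.
  by exists 0%N; apply/asboolP; exists [::] => //; rewrite span_nil dimv0.
have ubP m : P m -> (m <= \dim {:L})%N.
  by move=> /asboolP[X _ <-]; rewrite dimvS ?subvf.
case: (ex_maxnP exP ubP) => m /asboolP[X XA dX] maxm.
exists <<X>>%VS; split=> [x Ax | V AV]; last first.
  by apply/span_subvP => x /XA /AV.
have sX : (<<X>> <= <<x :: X>>)%VS by apply: sub_span => y yX; rewrite inE yX orbT.
have le_xX : (\dim <<x :: X>> <= m)%N.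
  apply: maxm; apply/asboolP; exists (x :: X) => // y.
  by rewrite inE => /predU1P[-> | /XA].
have /eqP -> : <<X>>%VS == <<x :: X>>%VS by rewrite eqEdim sX dX.
by rewrite memv_span ?mem_head.
Qed.

End NumberField.

(* Orders are quantified through representatives of isomorphism classes: the
   tower type and the successive minima are isomorphism invariants. *)
Definition in_S (R : realType) (T : seq nat) (L : fieldExtType rat)
    (O : {pred L}) : Prop :=
  [/\ degree L = tower_degree T, is_order O & has_tower_type R O T].

(* Main.v *)
(* Upper bound. Let A and B be the rational spans of the elements of length at
   most lambda_i and lambda_j. Products of short elements are short, so it is
   enough to show dim AB > i + j. Kneser's theorem for field extensions gives a
   subfield H with dim AB >= dim HA + dim HB - dim H. If dim AB <= i + j, then
   the degree h of H is not of the form n_1 ... n_s because i + j does not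
   overflow; moreover if HA (or HB) is a line over H, then A (or B) lies in H,
   so that H contains the subfields of the tower that A (or B) generates. No
   divisor h of n is compatible with these constraints for the tower types in
   question.

   Lower bound. If i + j carries out of the first u digits, take the field
   Q(z), z^n = 2, and list the powers of z as e_0, ..., e_(n-1) by reversing
   the mixed radix digits of the exponent, so that e_m lies in
   Q(2^(1/(n_1 ... n_s))) if and only if m < n_1 ... n_s. With
   w(m) = m + floor(m / (n_1 ... n_u)), the M^w(m) e_m span an order with
   lambda_m of size M^w(m), and w(i + j) = w(i) + w(j) + 1. *)

Require Import Defs.
From HB Require Import structures.
From mathcomp Require Import all_boot all_order all_algebra all_field.
From mathcomp Require Import all_classical reals.
From mathcomp Require Import complex zify ring.
Set Implicit Arguments.
Unset Strict Implicit.
Unset Printing Implicit Defensive.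
Import Order.TTheory GRing.Theory Num.Theory.

(** * Mixed radix *)

Lemma tower_degree_cons m T : tower_degree (m :: T) = (m * tower_degree T)%N.
Proof. by rewrite /tower_degree big_cons. Qed.

Lemma tower_degree_cat T T' :
  tower_degree (T ++ T') = (tower_degree T * tower_degree T')%N.
Proof. by rewrite /tower_degree big_cat. Qed.

Lemma tower_degree0 : tower_degree [::] = 1%N.
Proof. by rewrite /tower_degree big_nil. Qed.

Lemma tower_degree_gt0 T : is_tower_type T -> (0 < tower_degree T)%N.
Proof.
elim: T => [|m T IHT]; first by rewrite tower_degree0.
by rewrite tower_degree_cons => /andP[/ltnW m0 /IHT T0]; rewrite muln_gt0 m0.
Qed.

Lemma is_tower_type_take u T : is_tower_type T -> is_tower_type (take u T).
Proof. by move=> /allP H; apply/allP => m /mem_take /H. Qed.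

Lemma is_tower_type_drop u T : is_tower_type T -> is_tower_type (drop u T).
Proof. by move=> /allP H; apply/allP => m /mem_drop /H. Qed.

Lemma tower_degree_take_drop u T :
  tower_degree T = (tower_degree (take u T) * tower_degree (drop u T))%N.
Proof. by rewrite -tower_degree_cat cat_take_drop. Qed.

Lemma tower_degree_takeS u T : (u < size T)%N ->
  tower_degree (take u.+1 T) = (tower_degree (take u T) * nth 0%N T u)%N.
Proof.
by move=> ltu; rewrite (take_nth 0%N ltu) -cats1 tower_degree_cat
  tower_degree_cons tower_degree0 muln1.
Qed.

Lemma leq_tower_degree_take u v T : is_tower_type T -> (u <= v)%N ->
  (tower_degree (take u T) <= tower_degree (take v T))%N.
Proof.
move=> tT leuv; rewrite -(@take_takel _ u v) //
  [leqRHS](tower_degree_take_drop u).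
by rewrite leq_pmulr // tower_degree_gt0 // is_tower_type_drop //
  is_tower_type_take.
Qed.

Lemma ltn_tower_degree_drop u T : is_tower_type T -> (u < size T)%N ->
  (tower_degree (drop u.+1 T) < tower_degree T)%N.
Proof.
move=> tT ltu; rewrite (tower_degree_take_drop u.+1 T).
rewrite ltn_Pmull ?tower_degree_gt0 ?is_tower_type_drop //.
case: T tT ltu => //= m T /andP[m1 tT] _; rewrite tower_degree_cons.
by rewrite (leq_trans m1) // leq_pmulr // tower_degree_gt0 // is_tower_type_take.
Qed.

(** With [N_u = n_1 ... n_u], the terms of index at least [u] are multiples of [N_u], and the lower
    ones add up to less than [N_u]. *)
Lemma mixed_radix_mod T m d u : is_tower_type T -> mixed_radix T m d ->
  (u <= size T)%N ->
  (m %% tower_degree (take u T) =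
   \sum_(0 <= s < u) nth 0 d s * tower_degree (take s T))%N.
Proof.
move=> tT [_ dT ->] leu.
have lt_sum : (\sum_(0 <= s < u) nth 0 d s * tower_degree (take s T) <
  tower_degree (take u T))%N.
  elim: u leu => [|u IHu] ltu; first by rewrite big_geq // take0 tower_degree0.
  rewrite big_nat_recr //= tower_degree_takeS //.
  have := IHu (ltnW ltu); have := dT u ltu; nia.
rewrite -(big_mkord xpredT (fun s => nth 0 d s * tower_degree (take s T))%N).
rewrite (big_cat_nat (leq0n u) leu) //= -modnDmr.
have /dvdnP[q ->] : (tower_degree (take u T) %|
    \sum_(u <= s < size T) nth 0 d s * tower_degree (take s T))%N.
  rewrite big_nat_cond; apply: dvdn_sum => s /andP[/andP[leus _] _].
  rewrite dvdn_mull // -(@take_takel _ u s T leus) (tower_degree_take_drop u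
    (take s T)).
  by rewrite dvdn_mulr.
by rewrite modnMl addn0 modn_small.
Qed.

(** The form of no overflow used in the proof: no carry leaves the first [u] digits.
    [mod_no_overflow] is the converse. *)
Lemma no_overflow_mod T i j : is_tower_type T -> no_overflow T i j ->
  forall u, (u <= size T)%N ->
  (i %% tower_degree (take u T) + j %% tower_degree (take u T) <
    tower_degree (take u T))%N.
Proof.
move=> tT [di [dj [dk [Hi Hj Hk dD]]]] u leu.
rewrite (mixed_radix_mod tT Hi) // (mixed_radix_mod tT Hj) // -big_split /=.
rewrite (eq_big_nat _ _ (F2 := fun s => nth 0 dk s * tower_degree (take s T))%N).
  by rewrite -(mixed_radix_mod tT Hk) // ltn_mod tower_degree_gt0 //
    is_tower_type_take.
by move=> s /andP[_ ltsu]; rewrite -mulnDl dD // (leq_trans ltsu).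
Qed.

Definition digits T m : seq nat :=
  mkseq (fun s => (m %% tower_degree (take s.+1 T)) %/ tower_degree (take s T))%N
    (size T).

Lemma mixed_radix_digits T m : is_tower_type T -> (m < tower_degree T)%N ->
  mixed_radix T m (digits T m).
Proof.
move=> tT ltm; split; first by rewrite size_mkseq.
  move=> s lts; rewrite nth_mkseq //
    ltn_divLR ?tower_degree_gt0 ?is_tower_type_take //.
  by rewrite mulnC -tower_degree_takeS //
    ltn_mod tower_degree_gt0 ?is_tower_type_take.
rewrite -(big_mkord xpredT (fun s =>
  nth 0 (digits T m) s * tower_degree (take s T))%N).
suff partial u : (u <= size T)%N -> (m %% tower_degree (take u T) =
    \sum_(0 <= s < u) nth 0 (digits T m) s * tower_degree (take s T))%N.
  by rewrite -partial // take_size modn_small.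
elim: u => [_|u IHu ltu]; first by rewrite big_geq // take0 tower_degree0 modn1.
rewrite big_nat_recr //= -IHu ?(ltnW ltu) // nth_mkseq //.
rewrite {1}(divn_eq (m %% tower_degree (take u.+1 T)) (tower_degree (take u T)))
  addnC.
by rewrite modn_dvdm // tower_degree_takeS // dvdn_mulr.
Qed.

(** A digit is the quotient by [N_s = n_1 ... n_s] of the residue modulo [N_(s+1)]. The hypothesis
    at [s + 1] makes the residues add up, the one at [s] the quotients. *)
Lemma mod_no_overflow T i j : is_tower_type T -> (i + j < tower_degree T)%N ->
  (forall u, (u <= size T)%N ->
  (i %% tower_degree (take u T) + j %% tower_degree (take u T) <
    tower_degree (take u T))%N) ->
  no_overflow T i j.
Proof.
move=> tT ltij H; exists (digits T i), (digits T j), (digits T (i + j)).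
split; try (apply: mixed_radix_digits => //; lia).
move=> s lts; rewrite !nth_mkseq //.
have := H s.+1 lts; have := H s (ltnW lts).
set N := tower_degree (take s T); set N' := tower_degree (take s.+1 T).
have NN' : (N %| N')%N by rewrite /N' tower_degree_takeS // dvdn_mulr.
have N0 : (0 < N)%N by rewrite tower_degree_gt0 ?is_tower_type_take.
move=> HN HN'; rewrite -(modnDm i j N') (modn_small HN').
rewrite -(modn_dvdm i NN') -(modn_dvdm j NN') in HN.
by rewrite divnD // leqNgt HN addn0.
Qed.

(** * Excluding every divisor as the degree of a stabiliser *)

Definition admissible (T : seq nat) : Prop :=
  (tower_degree T < 8)%N
  \/ (tower_degree T = 8%N /\ T <> [:: 8%N])
  \/ prime (tower_degree T)
  \/ (exists p t : nat, prime p /\ T = nseq t p)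
  \/ (exists p : nat, prime p /\ T = [:: 2%N; p])
  \/ (exists p : nat, prime p /\ T = [:: 3%N; p]).

Lemma tower_degree1 m : tower_degree [:: m] = m.
Proof. by rewrite tower_degree_cons tower_degree0 muln1. Qed.

Lemma tower_degree_nseq t p : tower_degree (nseq t p) = p ^ t.
Proof. by rewrite /tower_degree big_nseq iter_muln_1. Qed.

Lemma tower_degree_eq1 T : is_tower_type T -> tower_degree T = 1 -> T = [::].
Proof.
case: T => // m T /andP[m1 tT]; rewrite tower_degree_cons => /eqP.
by rewrite muln_eq1 => /andP[/eqP m1' _]; rewrite m1' in m1.
Qed.

(* In the application [h] is the degree of the stabiliser [H] given by Kneser's
   theorem, and [a], [b] are the dimensions of [HA], [HB] over [H]; if [a = 1]
   then [A] is contained in [H]. *)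
Lemma no_stabiliser_degree T i j h a b :
  is_tower_type T -> admissible T -> i + j < tower_degree T ->
  (forall u, u <= size T ->
    i %% tower_degree (take u T) + j %% tower_degree (take u T) <
      tower_degree (take u T)) ->
  h %| tower_degree T -> i < a * h -> j < b * h -> (a + b) * h <= i + j + h ->
  (a = 1 -> forall u, u < size T -> tower_degree (take u T) <= i ->
     tower_degree (take u.+1 T) %| h) ->
  (b = 1 -> forall u, u < size T -> tower_degree (take u T) <= j ->
     tower_degree (take u.+1 T) %| h) ->
  False.
Proof.
move=> tT admT ltij noov hn ltia ltjb leab Ha Hb.
have h0 : 0 < h by case: h ltia {hn ltjb leab Ha Hb} => //; rewrite muln0.
(* If [h = n_1 ... n_u], the residues of [i] and [j] sum to less than [h] and the quotients are at
   most [a - 1] and [b - 1], so [i + j < (a + b - 1) h], against [leab]. *)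
have hN u : u <= size T -> h = tower_degree (take u T) -> False.
  move=> leu eqh; have := noov u leu; rewrite -eqh => lth.
  have qa : i %/ h < a by rewrite ltn_divLR.
  have qb : j %/ h < b by rewrite ltn_divLR.
  have := divn_eq i h; have := divn_eq j h; nia.
have a0 : 0 < a by case: a ltia {leab Ha hN}.
have b0 : 0 < b by case: b ltjb {leab Hb hN}.
have ha : h <= a * h by rewrite leq_pmull.
have hb : h <= b * h by rewrite leq_pmull.
rewrite mulnDl in leab.
have i0 : 0 < i by lia.
have j0 : 0 < j by lia.
have h1 : h <> 1 by move=> h1; apply: (hN 0) => //; rewrite take0 tower_degree0.
have hT : h <> tower_degree T by move=> hT; apply: (hN (size T)) => //;
  rewrite take_size.
case: T tT admT ltij noov hn Ha Hb hN hT => [|m T];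
  first by rewrite tower_degree0; lia.
move=> tT admT ltij noov hn Ha Hb hN hT.
have N0 : tower_degree (take 0 (m :: T)) = 1 by rewrite take0 tower_degree0.
have N1 : tower_degree (take 1 (m :: T)) = m by rewrite /= take0 tower_degree1.
have hm : h <> m by move=> hm; apply: (hN 1) => //; rewrite N1.
(* If [n_1] does not divide [h], then [a] and [b] are at least 2 by [Ha] and [Hb] at [u = 0], so
   [4 h <= i + j + h < n + h]. *)
have small : ~~ (m %| h) -> 3 * h < tower_degree (m :: T).
  move=> nmh; have a1 : a <> 1.
    by move=> a1; case/negP: nmh; rewrite -N1; apply: (Ha a1 0) => //; rewrite N0.
  have b1 : b <> 1.
    by move=> b1; case/negP: nmh; rewrite -N1; apply: (Hb b1 0) => //; rewrite N0.
  have a2 : 2 * h <= a * h by rewrite leq_mul2r; lia.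
  have b2 : 2 * h <= b * h by rewrite leq_mul2r; lia.
  lia.
have m1 : 1 < m by case/andP: tT.
have tT' : is_tower_type T by case/andP: tT.
have T0 : 0 < tower_degree T by rewrite tower_degree_gt0.
have primeh : prime h -> ~~ (m %| h).
  move=> /primeP[_ ph]; apply/negP => /ph /orP[]/eqP; lia.
have hk k : tower_degree (m :: T) = k * h -> 3 < k \/ m %| h.
  have [mh|/small lt3 eqk] := boolP (m %| h); first by right.
  by left; rewrite eqk ltn_mul2r h0 in lt3.
move: admT => [lt8|[[eq8 T8]|[pn|[[p [t [pp eqT]]]|admT]]]].
(* [n < 8]: as [h > 1], the cofactor [k] is at most 3, so [n_1] divides [h]. But [1 < h < n] makes
   [h] equal to 2 or 3, a prime different from [n_1]. *)
- have /dvdnP[k eqk] := hn; rewrite eqk in lt8 hT.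
  have k1 : k <> 1 by lia.
  have h2 : 1 < h by lia.
  have [k3|mh] := hk _ eqk; first by nia.
  have hp : prime h by have [->|->] : h = 2 \/ h = 3 by nia.
  by move: (primeh hp); rewrite mh.
- have m8 : m <> 8.
    move=> eqm; apply: T8; rewrite eqm; congr (_ :: _);
      apply: tower_degree_eq1 => //.
    by move: eq8; rewrite tower_degree_cons eqm; lia.
  have eqmT : m * tower_degree T = 8 by rewrite -tower_degree_cons.
  have m24 : m = 2 \/ m = 4 by nia.
  have h24 : h = 2 \/ h = 4.
    by move: hn hT; rewrite eq8 => /dvdnP[k eqk]; nia.
  have := noov 1 isT; rewrite N1 => noov1.
  have Ha0 : a = 1 -> m %| h by move=> a1; rewrite -N1; apply: (Ha a1 0);
    rewrite ?N0.
  have Hb0 : b = 1 -> m %| h by move=> b1; rewrite -N1; apply: (Hb b1 0);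
    rewrite ?N0.
  (* [h] and [n_1] are 2 and 4 in some order. If [h = 2], the inequalities force [i = j = 3], which
     carries modulo 4. If [h = 4], they force [a = b = 1], and [i] or [j] is at least 2, so
     [n_1 n_2] divides 4 and hence equals [h]. *)
  case: h24 => eqh.
    have m4 : m = 4 by case: m24 => // m2; case: hm; rewrite eqh m2.
    have a1 : a <> 1 by move=> /Ha0; rewrite m4 eqh.
    have b1 : b <> 1 by move=> /Hb0; rewrite m4 eqh.
    have [i3 j3] : i = 3 /\ j = 3.
      rewrite eqh in ltia ltjb leab; rewrite eq8 in ltij.
      by clear - a0 b0 a1 b1 ltia ltjb leab ltij; lia.
    by rewrite i3 j3 m4 in noov1.
  have m2 : m = 2 by case: m24 => // m4; case: hm; rewrite eqh m4.
  rewrite eqh in ltia ltjb leab; rewrite eq8 in ltij.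
  have [a1 b1] : a = 1 /\ b = 1 by clear - a0 b0 ltia ltjb leab ltij; lia.
  have T0' : 0 < size T by case: (T) eqmT => //; rewrite tower_degree0 m2.
  have N2 : tower_degree (take 2 (m :: T)) %| h.
    have [i2|j2] : 2 <= i \/ 2 <= j by clear - a0 b0 a1 b1 ltia ltjb leab ltij;
      lia.
      by apply: (Ha a1 1) => //; rewrite N1 m2.
    by apply: (Hb b1 1) => //; rewrite N1 m2.
  apply: (hN 2) => //; case: (T) tT' T0' N2 => // m' T' /andP[m'1 _] _.
  rewrite /= take0 !tower_degree_cons tower_degree0 muln1 m2 eqh.
  move=> /dvdnP[k]; clear - m'1; case: k => [|[|k]] eqk; nia.
- move/primeP: pn => [_ /(_ _ hn)] /orP[] /eqP; lia.
(* Every divisor of [p ^ t] is a product of initial entries of the type, excluded by [hN]. *)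
- rewrite eqT tower_degree_nseq in hn *.
  case/(dvdn_pfactor _ _ pp): hn => u leu eqh.
  apply: (hN u); rewrite eqT ?size_nseq // take_nseq // tower_degree_nseq //.
(* Type [(m, p)] with [m] equal to 2 or 3: a multiple of [m] dividing [m p] is [m] or [m p], both
   excluded. So [h] is prime to [m] and equals [p], with cofactor [m <= 3], against [hk]. *)
have [p [pp m3 mT]] : exists p, [/\ prime p, m <= 3 & T = [:: p]].
  by case: admT => -[p [pp [-> ->]]]; exists p.
have mp : m %| h -> False.
  move=> /dvdnP[h' eqh]; move: hn;
    rewrite mT tower_degree_cons tower_degree1 eqh mulnC.
  rewrite dvdn_pmul2l; last by lia.
  case/primeP: pp => _ /[apply] /orP[] /eqP eqh'.
    by apply: hm; rewrite eqh eqh' mul1n.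
  by apply: hT; rewrite eqh eqh' mT tower_degree_cons tower_degree1 mulnC.
have pm : prime m by have [->|->] : m = 2 \/ m = 3 by lia.
have /negP mh : ~ m %| h by exact: mp.
have : h %| p.
  rewrite -(@Gauss_dvdr _ m); last by rewrite coprime_sym prime_coprime.
  by rewrite -[p]tower_degree1 -mT -tower_degree_cons.
case/primeP: pp => _ /[apply] /orP[] /eqP // eqh.
have := hk m; rewrite mT tower_degree_cons tower_degree1 eqh.
case=> //; first by lia.
by rewrite -eqh => /mp.
Qed.

(* Writing [a < n_1 ... n_t] in mixed radix with the most significant digit
   first, [a = d_1 n_2...n_t + ... + d_t], the index is
   [d_1 + d_2 n_1 + ... + d_t n_1...n_(t-1)]. *)
Fixpoint radix_rev (T : seq nat) (a : nat) : nat :=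
  if T is m :: T' then
    a %/ tower_degree T' + m * radix_rev T' (a %% tower_degree T')
  else 0.

Lemma radix_rev0 T : radix_rev T 0 = 0.
Proof. by elim: T => //= m T IHT; rewrite div0n mod0n IHT muln0. Qed.

Lemma radix_rev_lt T a : is_tower_type T -> a < tower_degree T ->
  radix_rev T a < tower_degree T.
Proof.
elim: T a => [|m T IHT] a /=; first by rewrite tower_degree0.
case/andP => m1 tT; rewrite tower_degree_cons => lta.
have T0 := tower_degree_gt0 tT.
have := IHT _ tT (ltn_pmod a T0).
have : a %/ tower_degree T < m by rewrite ltn_divLR.
move: (radix_rev _ _) (a %/ _) => x y; clear; nia.
Qed.

Lemma radix_rev_inj T a b : is_tower_type T ->
  a < tower_degree T -> b < tower_degree T -> radix_rev T a = radix_rev T b ->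
    a = b.
Proof.
elim: T a b => [|m T IHT] a b /=; first by rewrite tower_degree0;
  case: a b => [|?] [].
case/andP => m1 tT; rewrite tower_degree_cons => lta ltb.
have T0 := tower_degree_gt0 tT.
have := IHT _ _ tT (ltn_pmod a T0) (ltn_pmod b T0).
rewrite -ltn_divLR // in lta; rewrite -ltn_divLR // in ltb.
move=> IH eqr; rewrite (divn_eq a (tower_degree T)) (divn_eq b (tower_degree T)).
have digit x y : x < m -> (x + m * y) %% m = x by move=> ltx;
  rewrite mulnC addnC modnMDl modn_small.
have eqd : a %/ tower_degree T = b %/ tower_degree T.
  by rewrite -(digit _ (radix_rev T (a %% tower_degree T)) lta) eqr digit.
rewrite eqd IH //; move: eqr; rewrite eqd => /addnI /eqP.
by rewrite eqn_pmul2l ?(ltnW m1) // => /eqP.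
Qed.

(* In the carried case, the carry moves from a digit to the previous one, which
   strictly lowers the index. *)
Lemma radix_rev_add T a b : is_tower_type T ->
  a < tower_degree T -> b < tower_degree T ->
  (a + b < tower_degree T -> radix_rev T (a + b) <= radix_rev T a + radix_rev T b)
  /\ (tower_degree T <= a + b ->
      radix_rev T (a + b - tower_degree T) < radix_rev T a + radix_rev T b).
Proof.
elim: T a b => [|m T IHT] a b /=; first by rewrite tower_degree0; lia.
case/andP => m1 tT; rewrite tower_degree_cons => lta ltb.
have T0 := tower_degree_gt0 tT;
  move: (tower_degree T) T0 IHT lta ltb => n n0 IHT lta ltb.
have lta' := ltn_pmod a n0; have ltb' := ltn_pmod b n0.
have [IH1 IH2] := IHT _ _ tT lta' ltb'.
rewrite -ltn_divLR // in lta; rewrite -ltn_divLR // in ltb.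
have ea := divn_eq a n; have eb := divn_eq b n.
move: (a %/ n) (a %% n) (b %/ n) (b %% n) ea eb lta ltb lta' ltb' IH1 IH2.
move=> d a' e b' -> -> ltd lte lta' ltb' IH1 IH2 {IHT a b tT}.
have divE q r : r < n -> (q * n + r) %/ n = q by move=> ltr;
  rewrite divnMDl // divn_small // addn0.
have modE q r : r < n -> (q * n + r) %% n = r by move=> ltr;
  rewrite modnMDl modn_small.
have [ltab|leab] := ltnP (a' + b') n.
  have {IH1 IH2} := IH1 ltab.
  have -> : d * n + a' + (e * n + b') = (d + e) * n + (a' + b')
    by rewrite mulnDl; lia.
  split=> [_|le].
    by rewrite divE // modE //; nia.
  have lem : m <= d + e by nia.
  have -> : (d + e) * n + (a' + b') - m * n = (d + e - m) * n + (a' + b')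
    by rewrite mulnBl; nia.
  by rewrite divE // modE //; nia.
have {IH1 IH2} := IH2 leab.
have -> : d * n + a' + (e * n + b') = (d + e).+1 * n + (a' + b' - n)
  by rewrite mulSn mulnDl; lia.
have ltc : a' + b' - n < n by lia.
move: (a' + b' - n) ltc => c ltc IH.
split=> [_|le].
  by rewrite divE // modE //; nia.
have lem : m <= (d + e).+1 by nia.
have -> : (d + e).+1 * n + c - m * n = ((d + e).+1 - m) * n + c
  by rewrite mulnBl; nia.
by rewrite divE // modE //; nia.
Qed.

(** For products of powers of [z]: as [z ^ n = 2], exponents add modulo [n] up to an integer
    factor. *)
Lemma radix_rev_modD T a b : is_tower_type T ->
  a < tower_degree T -> b < tower_degree T ->
  radix_rev T ((a + b) %% tower_degree T) <= radix_rev T a + radix_rev T b.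
Proof.
move=> tT lta ltb; have [H1 H2] := radix_rev_add tT lta ltb.
have [lt|le] := ltnP (a + b) (tower_degree T); first by rewrite modn_small // H1.
by rewrite -{1}(subnK le) modnDr modn_small ?(ltnW (H2 le)) //; lia.
Qed.

(** Dividing the index by [n_1 ... n_u] drops its [u] lowest digits, which are the [u] leading
    digits of [a]. *)
Lemma radix_rev_div T a u : is_tower_type T -> a < tower_degree T ->
  u <= size T ->
  radix_rev T a %/ tower_degree (take u T) =
  radix_rev (drop u T) (a %% tower_degree (drop u T)).
Proof.
elim: u T a => [|u IHu] T a tT lta leu.
  by rewrite take0 drop0 tower_degree0 divn1 modn_small.
case: T tT lta leu => // m T /= /andP[m1 tT];
  rewrite !tower_degree_cons ltnS => lta leu.
have T0 := tower_degree_gt0 tT.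
rewrite divnMA addnC mulnC divnMDl ?(ltnW m1) // [_ %/ m]divn_small ?addn0;
  last first.
  by rewrite ltn_divLR.
rewrite IHu ?ltn_pmod // modn_dvdm // [tower_degree T](tower_degree_take_drop u).
by rewrite dvdn_mull.
Qed.

(** This puts the powers of [z] of index below [n_1 ... n_u] in the subfield generated by
    [z ^ (n_(u+1) ... n_t)]. *)
Lemma radix_rev_dvd T a u : is_tower_type T -> a < tower_degree T ->
  u <= size T ->
  radix_rev T a < tower_degree (take u T) -> tower_degree (drop u T) %| a.
Proof.
move=> tT lta leu ltN; have tD := is_tower_type_drop u tT.
apply/eqP; apply: (radix_rev_inj tD); rewrite ?ltn_pmod ?tower_degree_gt0 //.
by rewrite radix_rev0 -radix_rev_div // divn_small.
Qed.

(** The exponent has a single nonzero digit, equal to 1. The corresponding power of [z] generates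
    the subfield of degree [n_1 ... n_(u+1)], and so comes right after the basis of the previous
    subfield. *)
Lemma radix_rev_gen T u : is_tower_type T -> u < size T ->
  radix_rev T (tower_degree (drop u.+1 T)) = tower_degree (take u T).
Proof.
elim: u T => [|u IHu] [|m T] //= /andP[m1 tT] ltu.
  rewrite drop0 tower_degree0 divnn modnn radix_rev0 muln0 addn0.
  by rewrite tower_degree_gt0.
have lt := ltn_tower_degree_drop tT ltu.
by rewrite divn_small // modn_small // IHu // tower_degree_cons.
Qed.

Lemma radix_rev_surj T k : is_tower_type T -> k < tower_degree T ->
  exists2 a, a < tower_degree T & radix_rev T a = k.
Proof.
move=> tT ltk; pose f (a : 'I_(tower_degree T)) :=
  Ordinal (radix_rev_lt tT (ltn_ord a)).
have f_inj : injective f.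
  by move=> a b /(congr1 val) /= /(radix_rev_inj tT (ltn_ord a) (ltn_ord b))
    /val_inj.
exists (invF f_inj (Ordinal ltk)) => //.
exact: (congr1 val (f_invF f_inj (Ordinal ltk))).
Qed.

Local Open Scope ring_scope.

(** * Kneser's theorem for number fields *)

Lemma cosetvK (F : fieldType) (L : fieldExtType F) (U : {vspace L}) (x : L) :
  x != 0 -> (U * <[x]> * <[x^-1]>)%VS = U.
Proof. by move=> x0; rewrite -prodvA prodv_line divff // prodv1. Qed.

Lemma cosetv_sub (F : fieldType) (L : fieldExtType F) (U V : {vspace L}) (x : L) :
  x != 0 -> (U * <[x]> <= V)%VS = (U <= V * <[x^-1]>)%VS.
Proof.
move=> x0; apply/idP/idP => [/(prodvSl <[x^-1]>)|/(prodvSl <[x]>)].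
  by rewrite cosetvK.
by have := cosetvK V (invr_neq0 x0); rewrite invrK => ->.
Qed.

Lemma prodvP1 (F : fieldType) (L : fieldExtType F) (A B V : {vspace L}) :
  (forall e, e \in B -> e != 0 -> (A * <[e]> <= V)%VS) -> (A * B <= V)%VS.
Proof.
move=> AV; apply/prodvP => u v Au Bv.
have [->|v0] := eqVneq v 0; first by rewrite mulr0 mem0v.
by apply: (subvP (AV v Bv v0)); rewrite memv_mul ?memv_line.
Qed.

(* Dyson's e-transform: replacing (A, B) by (A /\ B e^-1, B + A e) keeps the
   sum of the dimensions and does not enlarge the product. *)
Lemma dyson_transform (F : fieldType) (L : fieldExtType F) (A B : {vspace L}) :
  1 \in A -> exists (H : {subfield L}) (V : {vspace L}),
    [/\ (B <= V)%VS, (V <= A * B)%VS, (H * V <= V)%VS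
      & (\dim A + \dim B <= \dim V + \dim H)%N].
Proof.
have [m] := ubnP (\dim A); elim: m A B => // m IHm A B ltA A1.
have sBAB : (B <= A * B)%VS by rewrite -{1}[B]prod1v prodvSl.
(* When [A B] is inside [B], the induction ends: [B] is stable under the field generated by [A],
   whose dimension is at least [\dim A]. *)
have [sABB | nsABB] := boolP (A * B <= B)%VS.
  exists <<A>>%AS, B; split=> //; first exact: agenv_modl.
  by rewrite addnC leq_add2l dimvS ?sub_agenv.
(* Otherwise some dilate [A e] is not inside [B], which makes [A'] strictly smaller than [A]; 1
   stays in [A'] because [e] is in [B]. *)
have [e [Be e0 nAe]]: exists e, [/\ e \in B, e != 0 & ~~ (A * <[e]> <= B)%VS].
  apply: contrapT => nex; case/negP: nsABB; apply: prodvP1 => e Be e0.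
  by apply: contrapT => nAe; apply: nex; exists e; split=> //; apply/negP.
pose A' := (A :&: B * <[e^-1]>)%VS; pose B' := (B + A * <[e]>)%VS.
have sA'A : (A' <= A)%VS by exact: capvSl.
have A'1 : 1 \in A'.
  by rewrite memv_cap A1 -(divff e0) memv_mul ?memv_line.
have ltA' : (\dim A' < \dim A)%N.
  rewrite ltn_neqAle dimvS // andbT; apply: contra nAe => /eqP eqd.
  have /eqP <- : A' == A by rewrite eqEdim sA'A eqd /=.
  by rewrite cosetv_sub // capvSr.
have sA'B' : (A' * B' <= A * B)%VS.
  rewrite /B' prodvDr subv_add prodvSl //=.
  by rewrite prodvCA prodvSr // cosetv_sub // capvSr.
(* The dimensions of [B + A e] and of the intersection of [B] and [A e] sum to [\dim A + \dim B],
   and dividing that intersection by [e] lands in [A']. *)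
have dimA'B' : (\dim A + \dim B <= \dim A' + \dim B')%N.
  rewrite -(dim_cosetv A e0) [leqLHS]addnC -(dimv_sum_cap B) [leqLHS]addnC
    leq_add2r.
  rewrite -(dim_cosetv _ (invr_neq0 e0)) dimvS // subv_cap.
  by rewrite (prodvSl _ (capvSl _ _)) andbT cosetv_sub ?invr_eq0 // invrK capvSr.
have [H [V [BV VAB HV dV]]] := IHm A' B' (leq_trans ltA' ltA) A'1.
exists H, V; split=> //; last exact: leq_trans dV.
  by apply: subv_trans BV; exact: addvSl.
exact: subv_trans VAB _.
Qed.

Lemma nonzero_functional (V : vectType rat) (U : {vspace V}) (w : V) :
  w \notin U -> exists phi : {linear V -> rat^o},
    phi w != 0 /\ forall u, u \in U -> phi u = 0.
Proof.
move=> nUw.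
have nz : w - projv U w != 0.
  by apply: contra nUw; rewrite subr_eq0 => /eqP ->; apply: memv_proj.
have [i nzi] : exists i, coord (vbasis {:V}) i (w - projv U w) != 0.
  apply: contrapT => nex; case/negP: nz; apply/eqP.
  rewrite (coord_vbasis (memvf (w - projv U w))) big1 // => i _.
  have [->|nz] := eqVneq (coord (vbasis {:V}) i (w - projv U w)) 0;
    first by rewrite scale0r.
  by case: nex; exists i.
pose f := (fun x : V => coord (vbasis {:V}) i (x - projv U x) : rat^o).
have lin : linear f.
  by move=> a x y; rewrite /f linearP opprD addrACA -scalerBr linearP.
pose phi : {linear V -> rat^o} := HB.pack f (GRing.isLinear.Build _ _ _ _ f lin).
exists phi; split=> //= u Uu.
by rewrite /= /f projv_id // subrr linear0.
Qed.

(* A finite-dimensional space over an infinite field is not a finite union of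
   proper subspaces: a proper subspace meets the moment curve
   k |-> \sum_l k^l v_l in finitely many points. *)
Lemma spanning_colour (V : vectType rat) (A : {vspace V}) (C : finType)
    (col : V -> C) :
  exists c, forall U : {vspace V},
    (forall x, x \in A -> x != 0 -> col x = c -> x \in U) -> (A <= U)%VS.
Proof.
apply: contrapT => nex.
have /choice[U UP] : forall c, exists U : {vspace V},
    (forall x, x \in A -> x != 0 -> col x = c -> x \in U) /\ ~~ (A <= U)%VS.
  move=> c; apply: contrapT => nU; apply: nex; exists c => U UP.
  by apply: contrapT => nAU; apply: nU; exists U; split=> //; apply/negP.
pose v := vbasis A.
pose a (k : nat) := \sum_(l < \dim A) (k%:R ^+ l : rat) *: v`_l.
have Aa k : a k \in A.
  by apply: rpred_sum => l _;
    rewrite rpredZ // vbasis_mem // mem_nth // size_tuple.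
(* The polynomial is [phi] along the curve, for a linear form [phi] that vanishes on [U c] but not
   at some basis vector of [A]. *)
have /choice[p pP] : forall c, exists p : {poly rat},
    p != 0 /\ forall k, a k \in U c -> root p k%:R.
  move=> c; have [_ nAU] := UP c.
  have [l nUl] : exists l : 'I_(\dim A), v`_l \notin U c.
    apply: contrapT => nl; case/negP: nAU; rewrite -(span_basis (vbasisP A)).
    apply/span_subvP => x /(nthP 0)[m]; rewrite size_tuple => ltm <-.
    by apply: contrapT => /negP nx; apply: nl; exists (Ordinal ltm).
  have [phi [phil phiU]] := nonzero_functional nUl.
  exists (\poly_(i < \dim A) phi v`_i); split.
    apply/eqP => /polyP/(_ l); rewrite coef_poly ltn_ord coef0 => phil0.
    by rewrite phil0 eqxx in phil.
  move=> k /phiU ak0; apply/rootP; rewrite horner_poly -[RHS]ak0 linear_sum.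
  by apply: eq_bigr => i _; rewrite linearZ mulrC.
have nz_a k : a k != 0.
  have d0 : (0 < \dim A)%N.
    rewrite lt0n dimv_eq0; apply/eqP => A0.
    by have [_] := UP (col 0); rewrite A0 sub0v.
  apply/eqP => ak0; have /freeP := basis_free (vbasisP A).
  move=> /(_ (fun l => k%:R ^+ l) ak0 (Ordinal d0)) /eqP.
  by rewrite expr0 oner_eq0.
(* [a k] lies in [U c] for its own colour [c], so every natural number is a root of the product. *)
have rootP k : root (\prod_c p c) (k%:R : rat).
  rewrite (bigD1 (col (a k))) //= rootM.
  by rewrite (proj2 (pP _)) // (proj1 (UP _)).
have nz_P : \prod_c p c != 0.
  by apply/prodf_neq0 => c _; case: (pP c).
pose s := [seq k%:R : rat | k <- iota 0 (size (\prod_c p c))].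
suff: (size s < size (\prod_c p c)%R)%N by rewrite size_map size_iota ltnn.
apply: max_poly_roots => //; first by apply/allP => _ /mapP[k _ ->].
rewrite map_inj_uniq ?iota_uniq // => x y /eqP; rewrite eqr_nat; exact/eqP.
Qed.

(* Each nonzero [x] in [A] has an [H_x] and a [V_x] between [xB] and [AB] stable
   by [H_x]. There are finitely many subfields, so some [H] is [H_x] for all [x]
   in a spanning subset of [A], and it stabilises [AB]. *)
Lemma kneser_weak (L : fieldExtType rat) (C : finType)
    (col : {subfield L} -> C) (A B : {vspace L}) :
  injective col -> A != 0%VS -> exists H : {subfield L},
    (H * (A * B) <= A * B)%VS /\
    (\dim A + \dim B <= \dim (A * B) + \dim H)%N.
Proof.
move=> col_inj nzA.
have /choice[Hf HfP] : forall x : L, exists H : {subfield L},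
    x \in A -> x != 0 -> exists V : {vspace L},
    [/\ (<[x]> * B <= V)%VS, (V <= A * B)%VS, (H * V <= V)%VS
      & (\dim A + \dim B <= \dim V + \dim H)%N].
  move=> x; have [Ax|] := boolP (x \in A); last by exists 1%AS.
  have [->|x0] := eqVneq x 0; first by exists 1%AS.
  (* Scaling by [x^-1] brings 1 into the first factor; scaling [V] back by [x] changes neither its
     dimension nor its stability under [H]. *)
  have [|H [V [BV VAB HV dV]]] := @dyson_transform _ _ (A * <[x^-1]>)%VS B.
    by rewrite -(divff x0) memv_mul ?memv_line.
  exists H => _ _; exists (<[x]> * V)%VS; split.
  - exact: prodvSr.
  - have -> : (A * B)%VS = (<[x]> * (A * <[x^-1]> * B))%VS.
      by rewrite prodvA [(<[x]> * _)%VS]prodvCA prodv_line divff // prodv1.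
    exact: prodvSr.
  - by rewrite prodvCA prodvSr.
  - by rewrite [(_ * V)%VS]prodvC dim_cosetv // -(dim_cosetv A (invr_neq0 x0)).
have [c cP] := spanning_colour A (col \o Hf).
have [x [Ax x0 xc]] : exists x, [/\ x \in A, x != 0 & col (Hf x) = c].
  apply: contrapT => nex; have := nzA; rewrite -subv0 (cP 0%VS) // => x Ax x0 xc.
  by case: nex; exists x.
exists (Hf x); split; last first.
  have [V [_ VAB _ dV]] := HfP x Ax x0.
  by apply: leq_trans dV _; rewrite leq_add2r dimvS.
apply/prodvP => h y Hh.
have [->|h0] := eqVneq h 0; first by rewrite mul0r mem0v.
(* For fixed [b], the [x] with [x b] in [A B h^-1] form a subspace, so those of colour [c] suffice,
   as they span [A]; for these, [x b] lies in a [V] stable under [H]. *)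
suff /subvP sub : (A * B <= (A * B) * <[h^-1]>)%VS.
  move=> /sub ABy; rewrite mulrC; move: (memv_mul ABy (memv_line h)).
  by have := cosetvK (A * B)%VS (invr_neq0 h0); rewrite invrK => ->.
apply: prodvP1 => b Bb b0; rewrite cosetv_sub //.
apply: cP => x' Ax' x'0 x'c.
have [V [BV VAB HV _]] := HfP x' Ax' x'0.
have eqH : Hf x' = Hf x by apply: col_inj; rewrite xc -x'c.
have ABhxb : h * (x' * b) \in (A * B)%VS.
  apply: (subvP VAB); apply: (subvP HV); rewrite memv_mul ?eqH //.
  by apply: (subvP BV); rewrite memv_mul ?memv_line.
rewrite (_ : x' = h * (x' * b) * h^-1 * b^-1); last first.
  by rewrite [h * _]mulrC !mulfK.
by do 2![apply: memv_mul; last exact: memv_line].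
Qed.

(* Applying [kneser_weak] to [HA] and [HB], with [H] a stabiliser of [AB] of
   maximal dimension, yields no larger stabiliser. *)
Lemma linear_kneser (L : fieldExtType rat) (C : finType)
    (col : {subfield L} -> C) (A B : {vspace L}) :
  injective col -> A != 0%VS -> exists H : {subfield L},
    (H * (A * B) <= A * B)%VS /\
    (\dim (H * A) + \dim (H * B) <= \dim (A * B) + \dim H)%N.
Proof.
move=> col_inj nzA.
pose P m := `[< exists2 H : {subfield L}, (H * (A * B) <=
  A * B)%VS & \dim H = m >].
have exP : exists m, P m.
  by exists (\dim (1%AS : {subfield L})); apply/asboolP; exists 1%AS => //;
    rewrite prod1v.
have ubP m : P m -> (m <= \dim {:L})%N.
  by move=> /asboolP[H _ <-]; rewrite dimvS ?subvf.
case: (ex_maxnP exP ubP) => _ /asboolP[H sH <-] maxH.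
have HAB : (H * A * (H * B) = A * B)%VS.
  rewrite -prodvA [(A * (H * B))%VS]prodvCA (field_module_eq sH).
  exact: field_module_eq.
have [|H' []] := @kneser_weak _ _ col (H * A)%VS (H * B)%VS col_inj.
  by apply: contra nzA; rewrite -!subv0; apply: subv_trans; exact: field_subvMl.
rewrite HAB => sH' dH'; exists H; split=> //.
by apply: leq_trans dH' _; rewrite leq_add2l maxH //; apply/asboolP; exists H'.
Qed.

(** * Complex embeddings *)

Lemma primitive_element (L : fieldExtType rat) :
  exists z : L, [/\ <<1; z>>%VS = fullv, separable_poly (minPoly 1 z)
    & size (minPoly 1 z) = (\dim {:L}).+1].
Proof.
have sepL : separable 1 {:L}.
  apply/separableP => y _; apply: contrapT => /negP/separablePn_pchar[p].
  by rewrite (pchar_lalg L) pchar_num.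
have := eq_adjoin_separable_generator sepL (sub1v _).
set z := separable_generator _ _ => defL; exists z; split=> //.
  by have /separableP/(_ z (memvf z)) := sepL.
by rewrite size_minPoly adjoin_degreeE -defL dimv1 divn1.
Qed.

(** Each element of [L] is a polynomial in [z]. Evaluating it at [r] instead is well defined: a
    polynomial that vanishes at [z] is a multiple of the minimal polynomial, so it vanishes at
    [r]. *)
Lemma root_embedding (L : fieldExtType rat) (K : numFieldType) (z : L)
    (p : {poly rat}) (r : K) :
  <<1; z>>%VS = fullv -> map_poly (in_alg L) p = minPoly 1 z ->
  root (map_poly ratr p) r -> exists f : {rmorphism L -> K}, f z = r.
Proof.
move=> defL defp rp.
have ker q : (map_poly (in_alg L) q).[z] = 0 -> (map_poly ratr q).[r] = 0.
  move=> qz0; have : map_poly (in_alg L) p %| map_poly (in_alg L) q.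
    by rewrite defp minPoly_dvdp //; [exact: alg_polyOver | apply/rootP].
  rewrite dvdp_map => /dvdpP[s ->].
  by rewrite rmorphM hornerM (rootP rp) mulr0.
have /choice[g gP] x : exists q, x = (map_poly (in_alg L) q).[z].
  by apply/Fadjoin1_polyP; rewrite defL memvf.
have eval q : (map_poly ratr (g (map_poly (in_alg L) q).[z])).[r] =
  (map_poly ratr q).[r].
  apply/eqP; rewrite -subr_eq0 -hornerN -hornerD -rmorphB; apply/eqP/ker.
  by rewrite rmorphB hornerD hornerN -gP subrr.
pose f x := (map_poly ratr (g x)).[r] : K.
have fadd : zmod_morphism f.
  move=> x y; rewrite /f {1}(gP x) {1}(gP y) -hornerN -hornerD -rmorphB eval.
  by rewrite rmorphB hornerD hornerN.
have fmul : monoid_morphism f.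
  split=> [|x y]; rewrite /f.
    by have := eval 1; rewrite !rmorph1 !hornerC.
  by rewrite {1}(gP x) {1}(gP y) -hornerM -rmorphM eval rmorphM hornerM.
pose F : {rmorphism L -> K} := HB.pack f
  (GRing.isZmodMorphism.Build _ _ f fadd) (GRing.isMonoidMorphism.Build _ _ f
    fmul).
exists F; rewrite /F /= /f.
by have := eval 'X; rewrite !map_polyX !hornerX.
Qed.

Lemma rmorph_horner_alg (L : fieldExtType rat) (K : numFieldType)
    (f : {rmorphism L -> K}) (q : {poly rat}) (z : L) :
  f (map_poly (in_alg L) q).[z] = (map_poly ratr q).[f z].
Proof.
rewrite -horner_map /= -map_poly_comp; congr _.[_]; apply: eq_map_poly => a /=.
have ratrE : a%:A = ratr a :> L by rewrite -(fmorph_eq_rat (in_alg L)).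
by rewrite ratrE fmorph_rat.
Qed.

(** An embedding is determined by the image of a primitive element; the possible images are the
    roots of its minimal polynomial, distinct by separability. *)
Lemma embeddings_enum (R : realType) (L : fieldExtType rat) :
  exists (z : L) (e : 'I_(degree L) -> {rmorphism L -> R[i]}),
  [/\ <<1; z>>%VS = fullv, injective (fun k => e k z)
    & @embeddings R L = [set` [seq (e k : L ->
      R[i]) | k <- enum 'I_(degree L)]]%classic].
Proof.
have [z [defL sepz szp]] := primitive_element L.
have /polyOver1P[p defp] : minPoly 1 z \is a polyOver 1%VS by exact: minPolyOver.
have [rs prs] := closed_field_poly_normal (map_poly (ratr : rat -> R[i]) p).
have mon_p : p \is monic.
  by rewrite -(map_monic (in_alg L)) -defp monic_minPoly.
rewrite (monicP _) ?map_monic // scale1r in prs.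
have uniq_rs : uniq rs.
  by rewrite -separable_prod_XsubC -prs separable_map -(separable_map (in_alg L))
    -defp.
have sz_rs : size rs = degree L.
  have := congr1 (size \o polyseq) prs; rewrite /= size_map_poly size_prod_XsubC.
  by rewrite -(size_map_poly (in_alg L)) -defp szp => -[].
have mem_rs r : (r \in rs) = root (map_poly ratr p) r
  by rewrite prs root_prod_XsubC.
have /choice[e eP] (k : 'I_(degree L)) : exists f : {rmorphism L ->
  R[i]}, f z = rs`_k.
  by apply: (@root_embedding L _ z p) => //; rewrite -mem_rs mem_nth ?sz_rs.
exists z, e; split=> //.
  move=> k l; rewrite !eP => /eqP; rewrite nth_uniq ?sz_rs // => /eqP;
    exact: val_inj.
apply/seteqP; split=> [s /= [f ->] | s /= /mapP[k _ ->]]; last by exists (e k).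
have : f z \in rs.
  by rewrite mem_rs /root -rmorph_horner_alg -defp minPolyxx rmorph0.
move=> /(nthP 0)[k]; rewrite sz_rs => ltk fz.
apply/mapP; exists (Ordinal ltk); first by rewrite mem_enum.
apply/funext => x; have /Fadjoin1_polyP[q ->] : x \in <<1;
  z>>%VS by rewrite defL memvf.
by rewrite !rmorph_horner_alg eP fz.
Qed.

(** With [D] the intersection of [E] and [E'], a common minimal polynomial has its coefficients in
    [D], so the degree of [z] over [D] is at most that over [E], and [D = E]. *)
Lemma subfield_minPoly_inj (L : fieldExtType rat) (z : L) (M N : {subfield L}) :
  <<1; z>>%VS = fullv -> minPoly M z = minPoly N z -> M = N.
Proof.
move=> defL; have full (E : {subfield L}) : (adjoin_degree E z * \dim E =
  \dim {:L})%N.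
  rewrite -dim_Fadjoin; congr (\dim _); apply/eqP.
  by rewrite eqEsubv subvf -defL adjoinSl ?sub1v.
suff sub (E E' : {subfield L}) : minPoly E z = minPoly E' z -> (E <= E')%VS.
  by move=> eqMN; apply: val_inj; apply/eqP; rewrite eqEsubv !sub.
move=> eqE; pose D := capv_aspace E E'.
have : (size (minPoly D z) <= size (minPoly E z))%N.
  apply: dvdp_leq; first by rewrite monic_neq0 ?monic_minPoly.
  apply: minPoly_dvdp; last exact: root_minPoly.
  apply/polyOverP => i; rewrite memv_cap (polyOverP (minPolyOver E z)).
  by rewrite eqE (polyOverP (minPolyOver E' z)).
rewrite !size_minPoly ltnS => ledeg.
suff /eqP <- : (E :&: E')%VS == E by exact: capvSr.
rewrite eqEdim capvSl /= -(@leq_pmul2l (adjoin_degree E z)) //.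
by rewrite (full E) -(full D) leq_mul2r ledeg orbT.
Qed.

(** In [algC], the minimal polynomial of a primitive element over a subfield is the product of
    [X - x] over a set of conjugates. That set is the colour, and it determines the subfield. *)
Lemma finitely_many_subfields (L : fieldExtType rat) :
  exists (C : finType) (col : {subfield L} -> C), injective col.
Proof.
have [z [defL sepz szp]] := primitive_element L.
have /polyOver1P[p defp] : minPoly 1 z \is a polyOver 1%VS by exact: minPolyOver.
have [rs prs] := closed_field_poly_normal (map_poly (ratr : rat -> algC) p).
have mon_p : p \is monic.
  by rewrite -(map_monic (in_alg L)) -defp monic_minPoly.
rewrite (monicP _) ?map_monic // scale1r in prs.
have uniq_rs : uniq rs.
  by rewrite -separable_prod_XsubC -prs separable_map -(separable_map (in_alg L))
    -defp.
have [r rr] : exists r : algC, root (map_poly ratr p) r.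
  apply: closed_rootP; rewrite size_map_poly -(size_map_poly (in_alg L)) -defp
    szp.
  by rewrite eqSS -lt0n adim_gt0.
have [f fz] := root_embedding defL (esym defp) rr.
have fp : map_poly f (minPoly 1 z) = map_poly ratr p.
  rewrite defp -map_poly_comp; apply: eq_map_poly => a /=.
  have ratrE : a%:A = ratr a :> L by rewrite -(fmorph_eq_rat (in_alg L)).
  by rewrite ratrE fmorph_rat.
pose g (M : {subfield L}) := map_poly f (minPoly M z).
have gE M : g M = \prod_(x <- rs | root (g M) x) ('X - x%:P).
  have : g M %| \prod_(x <- rs) ('X - x%:P).
    by rewrite -prs -fp dvdp_map minPolyS ?sub1v.
  case/dvdp_prod_XsubC => m eq_gm.
  have -> : \prod_(x <- rs | root (g M) x) ('X - x%:P) =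
    \prod_(x <- mask m rs) ('X - x%:P).
    rewrite -big_filter; congr (\big[_/_]_(x <- _) _).
    have fm : mask m rs = [seq x <- rs | x \in mask m rs].
      by apply/(subseq_uniqP uniq_rs)/mask_subseq.
    rewrite [RHS]fm.
    by apply: eq_filter => x; rewrite (eqp_root eq_gm) root_prod_XsubC.
  apply/eqP; rewrite -eqp_monic //; first by rewrite map_monic monic_minPoly.
  exact: monic_prod_XsubC.
exists {set seq_sub rs}, (fun M => [set x | root (g M) (val x)]) =>
  M N /setP eqMN.
apply: (subfield_minPoly_inj defL); apply: (map_poly_inj f).
rewrite -/(g M) -/(g N) gE [RHS]gE.
rewrite big_seq_cond [RHS]big_seq_cond; apply: eq_bigl => x.
have [xr|] := boolP (x \in rs); last by [].
by have := eqMN (SeqSub xr); rewrite !inE.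
Qed.

(** * The length on a number field *)

Local Notation normc := ComplexField.Normc.normc.

Lemma normc_ge0 (R : rcfType) (x : R[i]) : 0 <= normc x.
Proof. by case: x => a b; exact: sqrtr_ge0. Qed.

Lemma normc_real (R : rcfType) (x : R) : normc (x%:C)%C = `|x|.
Proof. by rewrite /normc /= expr0n addr0 sqrtr_sqr. Qed.

Lemma le_normc_sum (R : rcfType) (I : Type) (r : seq I) (F : I -> R[i]) :
  normc (\sum_(i <- r) F i) <= \sum_(i <- r) normc (F i).
Proof.
elim: r => [|i r IHr]; first by rewrite !big_nil ComplexField.Normc.normc0.
by rewrite !big_cons (le_trans (le_normcD _ _)) // lerD2l.
Qed.

Lemma degree_gt0 (L : fieldExtType rat) : (0 < degree L)%N.
Proof. exact: adim_gt0. Qed.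

Lemma absLE (R : realType) (L : fieldExtType rat) :
  exists (z : L) (e : 'I_(degree L) -> {rmorphism L -> R[i]}),
  [/\ <<1; z>>%VS = fullv, injective (fun k => e k z)
    & forall x, absL R x =
        Num.sqrt ((degree L)%:R^-1 * \sum_k normc (e k x) ^+ 2)].
Proof.
have [z [e [defL e_inj eE]]] := embeddings_enum R L; exists z, e; split=> // x.
rewrite /absL eE -fsbig_seq.
  by rewrite big_map big_enum.
rewrite map_inj_uniq ?enum_uniq // => k l ekl; apply: e_inj;
  exact: (congr1 (@^~ z) ekl).
Qed.

Lemma absL_ge0 (R : realType) (L : fieldExtType rat) (x : L) : 0 <= absL R x.
Proof. exact: sqrtr_ge0. Qed.

Lemma absL1 (R : realType) (L : fieldExtType rat) : absL R (1 : L) = 1.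
Proof.
have [z [e [_ _ ->]]] := absLE R L.
under eq_bigr do rewrite rmorph1 ComplexField.Normc.normc1 expr1n.
by rewrite sumr_const card_ord mulVf ?sqrtr1 // pnatr_eq0 -lt0n degree_gt0.
Qed.

(** A sum of products of nonnegative terms is at most the product of the sums; the constant comes
    from the factor [1/n], which occurs once on the left and twice on the right under the square
    roots. *)
Lemma absLM (R : realType) (L : fieldExtType rat) (x y : L) :
  absL R (x * y) <= Num.sqrt (degree L)%:R * (absL R x * absL R y).
Proof.
have [z [e [_ _ E]]] := absLE R L; rewrite !E.
have S0 u : 0 <= \sum_k normc (e k u) ^+ 2 by rewrite sumr_ge0 // => k _;
  rewrite sqr_ge0.
have n0 : (0 : R) < (degree L)%:R by rewrite ltr0n degree_gt0.
rewrite -!sqrtrM ?mulr_ge0 ?invr_ge0 ?(ltW n0) //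
  ler_sqrt ?mulr_ge0 ?invr_ge0 ?(ltW n0) //.
rewrite [leRHS]mulrA mulVKf ?gt_eqF //
  [leRHS]mulrCA ler_wpM2l ?invr_ge0 ?(ltW n0) //.
rewrite mulr_suml ler_sum // => k _;
  rewrite rmorphM ComplexField.Normc.normcM exprMn.
by rewrite ler_wpM2l ?sqr_ge0 // (bigD1 k) //= lerDl sumr_ge0 // => l _;
  rewrite sqr_ge0.
Qed.

Lemma absLMn (R : realType) (L : fieldExtType rat) (m : nat) (x : L) :
  absL R (x *+ m) = m%:R * absL R x.
Proof.
have [z [e [_ _ E]]] := absLE R L; rewrite !E.
under eq_bigr do rewrite raddfMn normcMn -mulr_natl exprMn.
by rewrite -mulr_sumr mulrCA sqrtrM ?sqr_ge0 // sqrtr_sqr ger0_norm.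
Qed.

(** The embeddings of [x] are obtained from its coordinates in the powers of [z] by a Vandermonde
    matrix with distinct nodes. Its inverse bounds these coordinates by the length of [x]. *)
Lemma linear_bounded (R : realType) (L : fieldExtType rat) (phi : {linear L ->
  rat^o}) :
  exists2 c : R, 0 < c & forall x, `|ratr (phi x)| <= c * absL R x.
Proof.
have [z [e [defL e_inj E]]] := absLE R L; pose n := degree L.
have n0 : (0 : R) < n%:R by rewrite ltr0n degree_gt0.
have le_normc k x : normc (e k x) <= Num.sqrt n%:R * absL R x.
  rewrite E -sqrtrM ?ler0n // mulrA divff ?gt_eqF // mul1r.
  rewrite -[leLHS]ger0_norm ?normc_ge0 // -sqrtr_sqr ler_sqrt; last first.
    by rewrite sumr_ge0 // => l _; rewrite sqr_ge0.
  by rewrite (bigD1 k) //= lerDl sumr_ge0 // => l _; rewrite sqr_ge0.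
pose V := Vandermonde n (\row_k e k z).
have Vu : V \in unitmx.
  rewrite unitmxE unitfE det_Vandermonde; apply/prodf_neq0 => i _.
  apply/prodf_neq0 => j ltij; rewrite !mxE subr_eq0.
  by apply: contraTneq ltij => /e_inj ->; rewrite ltnn.
have szq x : exists2 q : {poly rat}, (size q <=
  n)%N & x = (map_poly (in_alg L) q).[z].
  have /polyOver1P[q defq] := Fadjoin_polyOver 1 z x.
  exists q; last by rewrite -defq Fadjoin_poly_eq // defL memvf.
  rewrite -(size_map_poly (in_alg L)) -defq (leq_trans (size_Fadjoin_poly _ _ _))
    //.
  by rewrite adjoin_degreeE defL dimv1 divn1.
pose c := \sum_(k < n) `|ratr (phi (z ^+ k))| * \sum_(l <
  n) normc (invmx V l k) * Num.sqrt n%:R : R.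
exists (c + 1).
  rewrite ltr_wpDl // sumr_ge0 // => k _; rewrite mulr_ge0 // sumr_ge0 // => l _.
  by rewrite mulr_ge0 ?normc_ge0 ?sqrtr_ge0.
move=> x; have [q leqn defx] := szq x.
have coef (k : 'I_n) : `|ratr q`_k| <= (\sum_(l <
  n) normc (invmx V l k) * Num.sqrt n%:R) * absL R x :> R.
  rewrite -normc_real fmorph_rat.
  have -> : ratr q`_k = \sum_l e l x * invmx V l k.
    have : (\row_l (ratr q`_l : R[i])) *m V = \row_l e l x.
      apply/rowP => l; rewrite !mxE defx rmorph_horner_alg (@horner_coef_wide _
        n) ?size_map_poly //.
      by apply: eq_bigr => i _; rewrite !mxE coef_map.
    move=> /(congr1 (mulmxr (invmx V))) /=; rewrite mulmxK // => /rowP/(_ k).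
    by rewrite !mxE => ->; apply: eq_bigr => l _; rewrite mxE.
  rewrite mulr_suml (le_trans (le_normc_sum _ _)) // ler_sum // => l _.
  by rewrite ComplexField.Normc.normcM mulrC -mulrA ler_wpM2l ?normc_ge0.
have -> : phi x = \sum_(k < n) q`_k * phi (z ^+ k).
  rewrite defx (@horner_coef_wide _ n) ?size_map_poly // linear_sum;
    apply: eq_bigr => k _.
  by rewrite coef_map /= mulr_algl linearZ.
rewrite rmorph_sum (le_trans (ler_norm_sum _ _ _)) //.
rewrite mulrDl mul1r ler_wpDr ?absL_ge0 //.
rewrite mulr_suml ler_sum // => k _; rewrite rmorphM normrM mulrC -mulrA.
by rewrite ler_wpM2l ?coef.
Qed.

(** * Successive minima *)

Lemma coord_bounded (R : realType) (L : fieldExtType rat) n (b : n.-tuple L) :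
  exists2 c : R, 0 < c & forall x k, `|ratr (coord b k x)| <= c * absL R x.
Proof.
have /choice[c cP] (k : 'I_n) : exists c : R,
    0 < c /\ forall x, `|ratr (coord b k x)| <= c * absL R x.
  by have [c] := @linear_bounded R L (coord b k); exists c.
exists (\sum_k c k + 1).
  by rewrite ltr_wpDl // sumr_ge0 // => k _; rewrite ltW ?(proj1 (cP k)).
move=> x k; rewrite (le_trans (proj2 (cP k) x)) // ler_wpM2r ?absL_ge0 //.
rewrite (bigD1 k) //= -addrA lerDl addr_ge0 // sumr_ge0 // => l _.
by rewrite ltW ?(proj1 (cP l)).
Qed.

Lemma absL_gt0 (R : realType) (L : fieldExtType rat) (x : L) :
  x != 0 -> 0 < absL R x.
Proof.
move=> x0; rewrite lt_def absL_ge0 andbT; apply: contra x0 => /eqP absx0.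
have [c _ cP] := coord_bounded R (vbasis {:L}).
rewrite (coord_vbasis (memvf x)) big1 // => k _.
have := cP x k; rewrite absx0 mulr0 normr_le0 fmorph_eq0 => /eqP ->.
by rewrite scale0r.
Qed.

Lemma mem_Qspan (L : fieldExtType rat) (A : set L) x : A x -> x \in Qspan A.
Proof. exact: (proj1 (QspanP A)). Qed.

Lemma Qspan_sub (L : fieldExtType rat) (A : set L) (V : {vspace L}) :
  (forall x, A x -> x \in V) -> (Qspan A <= V)%VS.
Proof. exact: (proj2 (QspanP A)). Qed.

Lemma coord_intspan (L : fieldExtType rat) n (b : n.-tuple L) (a : 'I_n ->
  int) k :
  free b -> coord b k (\sum_(i < n) b`_i *~ a i) = (a k)%:~R.
Proof.
move=> fb; rewrite -(coord_sum_free (fun i => (a i)%:~R) k fb).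
by congr coord; apply: eq_bigr => i _; rewrite scaler_int.
Qed.

(** The coordinates of a short element in a basis of the order are integers bounded by [c * r]; the
    shift by [N] encodes them as ordinals. *)
Lemma short_finite (R : realType) (L : fieldExtType rat) (O : {pred L}) (r : R) :
  is_order O -> exists s : seq L, forall x, short O r x -> x \in s.
Proof.
move=> [_ [b [bL bO]]]; have [c c0 cP] := coord_bounded R b.
pose N := Num.bound (c * r).
exists [seq \sum_(i < degree L) b`_i *~ ((f i : nat)%:Z - N%:Z)
  | f : {ffun 'I_(degree L) -> 'I_(N + N).+1} <- enum {: {ffun 'I_(degree L) ->
    'I_(N + N).+1}}].
move=> x [/bO[a xE] xr].
have aN k : (`|a k| <= N)%N.
  have := cP x k; rewrite xE coord_intspan ?(basis_free bL) // -xE ratr_int.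
  move=> /le_trans/(_ (ler_wpM2l (ltW c0) xr)) le_a.
  rewrite ltnW // -(ltr_nat R) natr_absz intr_norm (le_lt_trans le_a) //.
  by rewrite archi_boundP // mulr_ge0 ?(ltW c0) // (le_trans (absL_ge0 R x)).
apply/mapP; exists [ffun k => inord (absz (a k + N%:Z)%R)];
  first by rewrite mem_enum.
rewrite xE; apply: eq_bigr => k _; congr (_ *~ _).
by rewrite ffunE inordK; have := aN k; lia.
Qed.

Lemma seq_argmin (R : realType) (T : eqType) (f : T -> R) (P : T ->
  Prop) (s : seq T) :
  (exists2 x, x \in s & P x) ->
  exists x, [/\ x \in s, P x & forall y, y \in s -> P y -> f x <= f y].
Proof.
elim: s => [[] //|x s IHs] [w ws Pw].
have [/IHs[y [ys Py yP]]|nex] := pselect (exists2 y, y \in s & P y); last first.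
  have wx : w = x by apply: contrapT => /eqP nwx; apply: nex; exists w => //;
    rewrite inE (negPf nwx) in ws.
  exists x; rewrite mem_head -wx; split=> // y; rewrite inE.
  by case/predU1P => [-> _ //|ys Py]; case: nex; exists y.
have [[Px lexy]|nx] := pselect (P x /\ f x <= f y).
  exists x; rewrite mem_head; split=> // w';
    rewrite inE => /predU1P[-> //|ws' Pw'].
  exact: le_trans (yP _ ws' Pw').
exists y; rewrite inE ys orbT; split=> // w'; rewrite inE => /predU1P[-> Px|];
  last exact: yP.
by rewrite leNgt; apply/negP => /ltW lexy; apply: nx.
Qed.

(** [minimum] has default value 0, so attainment has to be proved. An admissible radius can be
    lowered to the length of the longest element that it allows, and up to [r0] there are finitely
    many such lengths. *)
Lemma lambdaP (R : realType) (L : fieldExtType rat) (O : {pred L}) (i : nat) :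
  is_order O -> (i < degree L)%N ->
  [/\ 0 < lambda R O i, (i < \dim (Qspan (short O (lambda R O i))))%N
    & forall r, 0 < r -> (i < \dim (Qspan (short O r)))%N -> lambda R O i <= r].
Proof.
move=> ordO ltin; pose S :=
  [set r : R | 0 < r /\ (i < \dim (Qspan (short O r)))%N]%classic.
have incr (r r' : R) : r <= r' ->
  (\dim (Qspan (short O r)) <= \dim (Qspan (short O r')))%N.
  move=> lerr'; apply/dimvS/Qspan_sub => x [Ox xr]; apply: mem_Qspan; split=> //.
  exact: le_trans lerr'.
have [r0 Sr0] : exists r0, S r0.
  have [_ [b [bL bO]]] := ordO.
  (* All basis elements have at most this length; the added 1 makes it positive. *)
  exists (\sum_(k < degree L) absL R b`_k + 1); split.
    by rewrite ltr_wpDl // sumr_ge0 // => k _; rewrite absL_ge0.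
  rewrite (leq_trans ltin) // -[leqLHS]/(\dim {:L}) dimvS // -(span_basis bL).
  apply/span_subvP => x /(nthP 0)[k]; rewrite size_tuple => ltk <-.
  apply: mem_Qspan; split.
    apply/bO; exists [ffun j => (j == Ordinal ltk)%:R].
    rewrite (bigD1 (Ordinal ltk)) //= ffunE eqxx big1 ?addr0 // => j /negPf nj.
    by rewrite ffunE nj.
  rewrite (bigD1 (Ordinal ltk)) //= -addrA lerDl addr_ge0 // sumr_ge0 // => j _.
  exact: absL_ge0.
have [s sP] := short_finite r0 ordO.
have reduce r : S r -> r <= r0 ->
  exists x, [/\ x \in s, S (absL R x) & absL R x <= r].
  move=> [r_gt0 ltir] ler.
  have sP' x : short O r x -> x \in s by move=> [Ox xr]; apply: sP; split=> //;
    exact: le_trans ler.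
  have [x [Ox xr x0]] : exists x, [/\ x \in O, absL R x <= r & x != 0].
    apply: contrapT => nex; move: ltir; rewrite ltnNge => /negP; apply.
    rewrite (@leq_trans 0) // leqn0 dimv_eq0 -subv0;
      apply: Qspan_sub => x [Ox xr].
    by rewrite memv0; apply: contrapT => /negP x0; apply: nex; exists x.
  have [|y [ys [Oy yr y0] yP]] := @seq_argmin R L (fun x => - absL R x)
      (fun x => [/\ x \in O, absL R x <= r & x != 0]) s.
    by exists x => //; exact: sP'.
  exists y; split=> //; split; first exact: absL_gt0.
  rewrite (leq_trans ltir) // dimvS //; apply: Qspan_sub => w [Ow wr].
  have [->|w0] := eqVneq w 0; first by rewrite mem0v.
  by apply: mem_Qspan; split=> //; rewrite -lerN2; apply: yP => //; exact: sP'.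
have [|x [xs Sx xP]] :=
  @seq_argmin R L (fun x => absL R x) (fun x => S (absL R x)) s.
  by have [x [xs Sx _]] := reduce r0 Sr0 (lexx _); exists x.
have minx : S (absL R x) /\ lbound S (absL R x).
  split=> // r Sr; have [ler|ltr] := leP r r0.
    by have [y [ys Sy ley]] := reduce r Sr ler; exact: le_trans (xP y ys Sy) ley.
  have [y [ys Sy ley]] := reduce r0 Sr0 (lexx _).
  exact: le_trans (xP y ys Sy) (le_trans ley (ltW ltr)).
have [] := @xgetPex _ 0 [set r | S r /\ lbound S r]%classic (ex_intro _ _ minx).
by rewrite -/(minimum S) -/(lambda R O i) => -[? ?] lb; split=> // r r0' lti;
  apply: lb.
Qed.

(** * The upper bound *)

(** The last two hypotheses are what [A] and [B] retain of the tower: if [H A] or [H B] has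
    dimension [\dim H], the subfields that they provide fall inside the stabiliser [H], so their
    degrees divide [\dim H]. *)
Lemma dim_prod_no_overflow (L : fieldExtType rat) (T : seq nat) (A B : {vspace
  L}) (i j : nat) :
  is_tower_type T -> admissible T -> degree L = tower_degree T ->
  (i + j < tower_degree T)%N -> no_overflow T i j ->
  1 \in A -> 1 \in B -> (i < \dim A)%N -> (j < \dim B)%N ->
  (forall u, (u < size T)%N -> (tower_degree (take u T) < \dim A)%N ->
    exists2 K : {subfield L}, \dim K = tower_degree (take u.+1 T) & (K <=
      agenv A)%VS) ->
  (forall u, (u < size T)%N -> (tower_degree (take u T) < \dim B)%N ->
    exists2 K : {subfield L}, \dim K = tower_degree (take u.+1 T) & (K <=
      agenv B)%VS) ->
  (i + j < \dim (A * B))%N.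
Proof.
move=> tT admT degL ltij noov A1 B1 ltiA ltjB towA towB.
rewrite ltnNge; apply/negP => leAB.
have nzA : A != 0%VS by rewrite -dimv_eq0 -lt0n (leq_ltn_trans _ ltiA).
have [C [col col_inj]] := finitely_many_subfields L.
have [H [_ kH]] := linear_kneser B col_inj nzA.
have modH (X : {vspace L}) : (H * (H * X) <= H * X)%VS by rewrite prodvA prodv_id.
have /dvdnP[a dA] := field_module_dimS (modH A).
have /dvdnP[b dB] := field_module_dimS (modH B).
(* As 1 is in [X], [H] is inside [H X]; equality of dimensions then puts [X] inside [H]. *)
have contained (X : {vspace L}) : 1 \in X -> \dim (H * X) = \dim H ->
  (agenv X <= H)%VS.
  move=> X1 dX; rewrite -(subfield_closed H); apply: agenvS.
  suff /eqP -> : (H : {vspace L}) == (H * X)%VS by exact: field_subvMl.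
  by rewrite eqEdim dX leqnn andbT -{1}[val H]prodv1 prodvSr.
apply: (@no_stabiliser_degree T i j (\dim H) a b) => //.
- exact: no_overflow_mod.
- by rewrite -degL field_dimS ?subvf.
- by rewrite -dA (leq_trans ltiA) // dimvS ?field_subvMl.
- by rewrite -dB (leq_trans ltjB) // dimvS ?field_subvMl.
- by rewrite mulnDl -dA -dB (leq_trans kH) // leq_add2r.
- move=> a1 u ltu leu; have [|K <- sK] := towA u ltu;
  first exact: leq_ltn_trans ltiA.
  by apply: field_dimS; apply: subv_trans sK _; apply: contained;
    rewrite // dA a1 mul1n.
- move=> b1 u ltu leu; have [|K <- sK] := towB u ltu;
  first exact: leq_ltn_trans ltjB.
  by apply: field_dimS; apply: subv_trans sK _; apply: contained;
    rewrite // dB b1 mul1n.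
Qed.

Lemma is_tower_nth (L : fieldExtType rat) (K : {subfield L}) (Ks : seq {subfield
  L}) :
  path (fun K E : {subfield L} => (K <= E)%VS && (K != E)) K Ks ->
  (forall u, (u <= size Ks)%N -> \dim (nth 1%AS (K :: Ks) u) =
    (\dim K * tower_degree (take u (pairmap (fun K E : {subfield L} =>
      \dim_K E) K Ks)))%N)
  /\ (forall u v, (u <= v <= size Ks)%N ->
    (nth 1%AS (K :: Ks) u <= nth 1%AS (K :: Ks) v)%VS).
Proof.
elim: Ks K => [|E Ks IHKs] K /=.
  move=> _; split=> [[|u] // _|u v]; first by rewrite tower_degree0 muln1.
  by move=> /andP[leuv lev]; have [-> ->] : u = 0%N /\ v = 0%N by lia.
case/andP => /andP[sKE _] /IHKs[IHd IHs]; split=> [[|u] leu|[|u] [|v] leuv] //.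
- by rewrite take0 tower_degree0 muln1.
- by rewrite /= tower_degree_cons mulnA [(\dim K * _)%N]mulnC -(dim_sup_field
  sKE); apply: IHd.
- by apply: subv_trans sKE _; exact: (IHs 0%N).
- exact: IHs.
Qed.

(** The generated field is some [K_v]. If [v <= u], its degree would be at most [n_1 ... n_u], less
    than the dimension of the span that it contains. *)
Lemma tower_type_adjoin (R : realType) (L : fieldExtType rat) (O : {pred L}) (T :
  seq nat)
    (r : R) (u : nat) :
  is_tower_type T -> has_tower_type R O T -> 0 < r -> (u < size T)%N ->
  (tower_degree (take u T) < \dim (Qspan (short O r)))%N ->
  exists2 K : {subfield L}, \dim K = tower_degree (take u.+1 T)
    & (K <= agenv (Qspan (short O r)))%VS.
Proof.
move=> tT [Ks [towKs KsP eqT]] r0 ltu ltd.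
have [dimKs subKs] := is_tower_nth towKs.
have szT : size T = size Ks by rewrite eqT size_pairmap.
have dimT v : (v <= size Ks)%N ->
  \dim (nth 1%AS (1%AS :: Ks) v) = tower_degree (take v T).
  by move=> lev; rewrite dimKs // dimv1 mul1n eqT.
have : Qadjoin (short O r) \in (1%AS : {subfield L}) :: Ks by apply/KsP; exists r.
move=> /(nthP 1%AS)[v]; rewrite ltnS => lev eqv.
exists (nth 1%AS (1%AS :: Ks) u.+1); first by rewrite dimT -?szT.
have -> : agenv (Qspan (short O r)) = nth 1%AS (1%AS :: Ks) v by rewrite eqv.
apply: subKs; rewrite lev andbT ltnNge; apply/negP => levu.
have : (\dim (nth 1%AS (1%AS :: Ks) v) < \dim (Qspan (short O r)))%N.
  by rewrite dimT // (leq_ltn_trans _ ltd) // leq_tower_degree_take.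
by rewrite eqv ltnNge dimvS // sub_agenv.
Qed.

Lemma prod_short (R : realType) (L : fieldExtType rat) (O : {pred L}) (r r' : R) :
  is_order O ->
  (Qspan (short O r) * Qspan (short O r') <=
   Qspan (short O (Num.sqrt (degree L)%:R * (r * r'))))%VS.
Proof.
move=> [[_ _ OM] _]; set Q := Qspan (short O (_ * _)).
have QM x y : short O r x -> short O r' y -> x * y \in Q.
  move=> [Ox xr] [Oy yr]; apply: mem_Qspan; split; first exact: OM.
  by rewrite (le_trans (absLM _ _ _)) // ler_wpM2l ?sqrtr_ge0 // ler_pM //
    absL_ge0.
(* The inclusion passes from short elements to their spans one factor at a time, by dividing by the
   other factor. *)
apply: prodvP1 => b Bb b0; rewrite cosetv_sub //; apply: Qspan_sub => x xr.
have [->|x0] := eqVneq x 0; first by rewrite mem0v.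
suff : b * x \in Q by move=> bxQ;
  rewrite -[x](mulKf b0) mulrC memv_mul ?memv_line.
have sB : (Qspan (short O r') <= Q * <[x^-1]>)%VS.
  apply: Qspan_sub => y yr; rewrite -[y](mulfK x0) memv_mul ?memv_line // mulrC.
  exact: QM.
have := cosetvK Q (invr_neq0 x0); rewrite invrK => <-.
by rewrite memv_mul ?memv_line // (subvP sB).
Qed.

Lemma lambda_le_mul (R : realType) (L : fieldExtType rat) (O : {pred L}) (T : seq
  nat) (i j : nat) :
  is_tower_type T -> admissible T -> in_S R T O -> (i + j < tower_degree T)%N ->
  no_overflow T i j ->
  lambda R O (i + j) <=
    Num.sqrt (tower_degree T)%:R ^+ 3 * lambda R O i * lambda R O j.
Proof.
move=> tT admT [degL ordO towO] ltij noov; rewrite -degL; set c := Num.sqrt _.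
have [ltin ltjn] : (i < degree L)%N /\ (j < degree L)%N by rewrite degL; lia.
have [li0 ltiA _] := lambdaP R ordO ltin.
have [lj0 ltjB _] := lambdaP R ordO ltjn.
have c0 : 0 <= c by exact: sqrtr_ge0.
have c1 : 1 <= c by rewrite -[leLHS]sqrtr1 ler_wsqrtr // ler1n degree_gt0.
(* A nonzero [x] of length [lambda 0] has a nonzero square of length at most
   [c * lambda 0 ^+ 2], whence [1 <= c * lambda 0]. *)
have c_lambda k : (k < degree L)%N -> 1 <= c * lambda R O k.
  move=> ltk; have [l0 dim0 min0] := lambdaP R ordO (degree_gt0 L).
  have [lk0 dimk _] := lambdaP R ordO ltk.
  have le0k : lambda R O 0 <= lambda R O k by apply: min0 => //;
    exact: leq_ltn_trans dimk.
  have pos : 0 < c * (lambda R O 0 * lambda R O 0).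
    by rewrite mulr_gt0 ?mulr_gt0 // (lt_le_trans _ c1).
  rewrite (le_trans _ (ler_wpM2l c0 le0k)) //.
  rewrite -(ler_pM2r l0) mul1r -mulrA min0 //.
  rewrite lt0n dimv_eq0; apply: contraL dim0 => /eqP sq0.
  rewrite -leqNgt leqn0 dimv_eq0 -subv0; apply: Qspan_sub => x xr.
  have : x * x \in (Qspan (short O (lambda R O 0)) * Qspan (short O (lambda R O
    0)))%VS.
    by rewrite memv_mul ?mem_Qspan.
  by move/(subvP (prod_short _ _ ordO)); rewrite sq0 !memv0 mulf_eq0 orbb.
(* A radius of at least 1 puts 1 in both spans. By [c_lambda] this costs a factor [c] for each of
   [i] and [j]; the third [c] in the constant comes from [absLM]. *)
pose r k := Num.max (lambda R O k) 1.
have r1 k : 1 <= r k by rewrite le_max lexx orbT.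
have r0 k : 0 < r k by exact: lt_le_trans (r1 k).
have rc k : (k < degree L)%N -> 0 < lambda R O k -> r k <= c * lambda R O k.
  by move=> ltk lk0; rewrite ge_max c_lambda // andbT ler_peMl // ltW.
have dim_r k : (\dim (Qspan (short O (lambda R O k))) <=
  \dim (Qspan (short O (r k))))%N.
  apply/dimvS/Qspan_sub => x [Ox xr]; apply: mem_Qspan; split=> //.
  by rewrite le_max xr.
have one k : 1 \in Qspan (short O (r k)).
  by apply: mem_Qspan; split; [case: ordO => -[] | rewrite absL1].
have ltAB : (i + j < \dim (Qspan (short O (r i)) * Qspan (short O (r j))))%N.
  apply: (@dim_prod_no_overflow L T) => //.
  - exact: leq_trans (dim_r i).
  - exact: leq_trans (dim_r j).
  - by move=> u; apply: tower_type_adjoin.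
  - by move=> u; apply: tower_type_adjoin.
have [_ _ minij] : [/\ 0 < lambda R O (i + j), (i + j <
  \dim (Qspan (short O (lambda R O (i + j)))))%N
    & forall r, 0 < r -> (i + j < \dim (Qspan (short O r)))%N ->
      lambda R O (i + j) <= r].
  by apply: lambdaP; rewrite ?degL.
apply: (@le_trans _ _ (c * (r i * r j))).
  apply: minij; first by rewrite !mulr_gt0 // (lt_le_trans _ c1).
  by rewrite (leq_trans ltAB) // dimvS // prod_short.
have -> : c ^+ 3 * lambda R O i * lambda R O j =
    c * ((c * lambda R O i) * (c * lambda R O j)) by ring.
by rewrite ler_wpM2l // ler_pM ?rc // ltW.
Qed.

(** * Orders spanned by multiples of a basis *)

Definition intspan (V : zmodType) n (b : n.-tuple V) : {pred V} :=
  fun x => `[< inIntSpan b x >].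

Lemma intspanP (V : zmodType) n (b : n.-tuple V) x :
  reflect (inIntSpan b x) (x \in intspan b).
Proof. exact: asboolP. Qed.

Lemma intspan_zmod_closed (V : zmodType) n (b : n.-tuple V) :
  zmod_closed (intspan b).
Proof.
split; first by apply/intspanP; exists [ffun=> 0]; rewrite big1 // => i _;
  rewrite ffunE mulr0z.
move=> x y /intspanP[a ->] /intspanP[c ->]; apply/intspanP;
  exists [ffun i => a i - c i].
by rewrite -sumrB; apply: eq_bigr => i _; rewrite ffunE mulrzBr.
Qed.

Lemma intspan_nth (V : zmodType) n (b : n.-tuple V) (i : 'I_n) : b`_i \in intspan
  b.
Proof.
apply/intspanP; exists [ffun j => (j == i)%:R].
rewrite (bigD1 i) //= ffunE eqxx mulr1z big1 ?addr0 // => j /negPf nj.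
by rewrite ffunE nj mulr0z.
Qed.

Lemma intspan_sum (V : zmodType) n (b : n.-tuple V) (I : Type) (r : seq I) (F : I
  -> V)
    (a : I -> int) :
  (forall i, F i \in intspan b) -> \sum_(i <- r) F i *~ a i \in intspan b.
Proof.
have [b0 bB] := intspan_zmod_closed b.
have bN x : x \in intspan b -> - x \in intspan b by move=> bx; rewrite -sub0r bB.
have bD x y : x \in intspan b -> y \in intspan b -> x + y \in intspan b.
  by move=> bx Fby; rewrite -[y]opprK bB ?bN.
move=> bF; elim: r => [|i r IHr]; first by rewrite big_nil.
rewrite big_cons bD //; case: (a i) => m.
  by rewrite -pmulrn; elim: m => [|m IHm]; rewrite ?mulr0n // mulrS bD.
by rewrite NegzE mulrNz bN // -pmulrn; elim: {m}m.+1 => [|m IHm];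
  rewrite ?mulr0n // mulrS bD.
Qed.

Lemma intspan_mulrn (V : zmodType) n (b : n.-tuple V) x k :
  x \in intspan b -> x *+ k \in intspan b.
Proof.
move=> bx; have := @intspan_sum _ _ b _ [:: tt] (fun=> x) (fun=> k%:Z) (fun=> bx).
by rewrite big_seq1 -pmulrn.
Qed.

Lemma intspan_mul_closed (L : fieldExtType rat) n (b : n.-tuple L) :
  (forall i j : 'I_n, b`_i * b`_j \in intspan b) ->
  {in intspan b &, forall x y, x * y \in intspan b}.
Proof.
move=> bM _ _ /intspanP[a ->] /intspanP[c ->]; rewrite mulr_suml.
under eq_bigr do rewrite mulrzAl.
apply: intspan_sum => i; rewrite mulr_sumr.
under eq_bigr do rewrite mulrzAr.
exact: intspan_sum.
Qed.

Definition weighted (V : zmodType) n (E : n.-tuple V) (g : nat -> nat) (M : nat) :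
    n.-tuple V := [tuple E`_i *+ M ^ g i | i < n].

Lemma weightedE (V : zmodType) n (E : n.-tuple V) (g : nat ->
  nat) (M : nat) (i : 'I_n) :
  (weighted E g M)`_i = E`_i *+ M ^ g i.
Proof. by rewrite -tnth_nth tnth_mktuple. Qed.

Lemma weighted_basis (L : fieldExtType rat) (E : (degree L).-tuple L) g M :
  (0 < M)%N -> basis_of {:L} E -> basis_of {:L} (weighted E g M).
Proof.
move=> M0 basE; rewrite basisEfree size_tuple leqnn subvf !andbT.
have /freeP freeE := basis_free basE.
apply/freeP => k; under eq_bigr do rewrite weightedE -scaler_nat scalerA.
move=> /freeE k0 i; have /eqP := k0 i.
by rewrite mulf_eq0 pnatr_eq0 expn_eq0 eqn0Ngt M0 orbF => /eqP.
Qed.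

Lemma weighted_coord (L : fieldExtType rat) (E : (degree L).-tuple L) g M x :
  basis_of {:L} E -> x \in intspan (weighted E g M) ->
  forall i, exists a : int, coord E i x = (M ^ g i)%:R * a%:~R.
Proof.
move=> basE /intspanP[a ->] i; exists (a i).
rewrite -(coord_sum_free (fun i => (M ^ g i)%:R * (a i)%:~R) i (basis_free basE)).
congr coord; apply: eq_bigr => j _.
by rewrite weightedE mulrC -scalerA scaler_int scaler_nat.
Qed.

(** Subadditivity of [g] along the multiplication table leaves the integral factor
    [M ^ (g i + g j - g c)] in each product. *)
Lemma weighted_order (L : fieldExtType rat) (E : (degree L).-tuple L) (g : nat ->
  nat) M :
  (0 < M)%N -> basis_of {:L} E -> E`_0 = 1 -> g 0%N = 0%N ->
  (forall i j : 'I_(degree L), exists (c : 'I_(degree L)) (m : nat),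
      E`_i * E`_j = E`_c *+ m /\ (g c <= g i + g j)%N) ->
  is_order (intspan (weighted E g M)).
Proof.
move=> M0 basE E0 g0 EM; set O := intspan _.
have [O0 OB] := intspan_zmod_closed (weighted E g M).
split; last first.
  by exists (weighted E g M); split=> [|x];
    [exact: weighted_basis | by split=> /intspanP].
split=> //.
  by have := intspan_nth (weighted E g M) (Ordinal (degree_gt0 L));
    rewrite weightedE /= E0 g0.
apply: intspan_mul_closed => i j; rewrite !weightedE.
have [c [m [EME le_g]]] := EM i j.
rewrite mulrnAr mulrnAl EME -!mulrnA.
have -> : (m * (M ^ g i * M ^ g j) = M ^ g c * (m * M ^ (g i + g j - g c)))%N.
  by rewrite -expnD -(subnKC le_g) expnD addKn; lia.
by rewrite mulrnA -weightedE intspan_mulrn // intspan_nth.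
Qed.

(** [C] is fixed before [M], so that [M] can later be taken large compared with [C]. The second
    bound holds because the coordinate is a nonzero integer times [M ^ g i]. *)
Lemma weighted_bounds (R : realType) (L : fieldExtType rat) (E : (degree
  L).-tuple L)
    (g : nat -> nat) :
  basis_of {:L} E -> exists2 C : R, 0 < C & forall M, (0 < M)%N ->
    (forall i : 'I_(degree L), absL R (E`_i *+ M ^ g i) <= C * M%:R ^+ g i) /\
    (forall x (i : 'I_(degree L)), x \in intspan (weighted E g M) ->
       coord E i x != 0 -> M%:R ^+ g i <= C * absL R x).
Proof.
move=> basE; have [c c0 cP] := coord_bounded R E.
have S0 : 0 <= \sum_(i < degree L) absL R E`_i by rewrite sumr_ge0 // => i _;
  rewrite absL_ge0.
exists (c + \sum_(i < degree L) absL R E`_i); first by rewrite ltr_wpDr.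
move=> M M0; split=> [i|x i Ox].
  rewrite absLMn natrX mulrC ler_wpM2r ?exprn_ge0 // ler_wpDl ?(ltW c0) //.
  by rewrite (bigD1 i) //= lerDl sumr_ge0 // => j _; rewrite absL_ge0.
have [a eqa] := weighted_coord basE Ox i.
move=> nz; have := cP x i; move: nz; rewrite eqa mulf_eq0 negb_or => /andP[_ a0].
rewrite rmorphM /= ratr_int ratr_nat normrM normr_nat natrX => lec.
rewrite mulrDl ler_wpDr ?mulr_ge0 ?absL_ge0 // (le_trans _ lec) //.
rewrite ler_peMr ?exprn_ge0 // -intr_norm ler1z.
by move: a0; rewrite intr_eq0; lia.
Qed.

Section Weighted.

Variables (R : realType) (L : fieldExtType rat) (E : (degree L).-tuple L) (g :
  nat -> nat).
Hypothesis basE : basis_of {:L} E.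
Hypothesis g_incr : forall i j : nat, (i < j)%N -> (g i < g j)%N.
Variables (C : R) (M : nat).
Hypothesis C0 : 0 < C.
Hypothesis M0 : (0 < M)%N.
(* Consecutive weights are so far apart that the elements of length at most a
   given bound span an initial segment of [E]. *)
Hypothesis CM : C ^+ 2 < M%:R.
Hypothesis upper : forall i : 'I_(degree L), absL R (E`_i *+ M ^ g i) <=
  C * M%:R ^+ g i.
Hypothesis lower : forall x (i : 'I_(degree L)), x \in intspan (weighted E g M) ->
       coord E i x != 0 -> M%:R ^+ g i <= C * absL R x.

Let O := intspan (weighted E g M).

Let g_leq i j : (i <= j)%N -> (g i <= g j)%N.
Proof. by rewrite leq_eqVlt => /predU1P[-> //|/g_incr/ltnW]. Qed.

Let M1 : 1 <= M%:R :> R. Proof. by rewrite ler1n. Qed.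

Lemma weighted_take_sub k (r : R) : (k <= degree L)%N ->
  (forall i, (i < k)%N -> C * M%:R ^+ g i <= r) ->
    (<<take k E>> <= Qspan (short O r))%VS.
Proof.
move=> lek ler; apply/span_subvP => x xk; have [i0] := elimT (nthP 0) xk.
rewrite size_take size_tuple; move: i0 => i lti <-.
have ltik : (i < k)%N by move: lti; case: ifP => // /negbT; lia.
have ltin := leq_trans ltik lek.
rewrite nth_take //; have : (weighted E g M)`_(Ordinal ltin) \in Qspan (short O
  r).
  apply: mem_Qspan; split; first exact: (intspan_nth _ (Ordinal ltin)).
  by rewrite weightedE (le_trans (upper (Ordinal ltin))) ?ler.
rewrite weightedE -scaler_nat /= => /(memvZ ((M ^ g i)%:R^-1)).
by rewrite scalerK // pnatr_eq0 expn_eq0 eqn0Ngt M0.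
Qed.

Lemma weighted_sub_take k (r : R) : (forall x (i : 'I_(degree L)), short O r x ->
  (k <= i)%N ->
  coord E i x = 0) -> (Qspan (short O r) <= <<take k E>>)%VS.
Proof.
move=> coord0; apply: Qspan_sub => x xr; rewrite (coord_basis basE (memvf x)).
apply: memv_suml => i _; have [leki|ltik] := leqP k i;
  first by rewrite coord0 // scale0r mem0v.
rewrite memvZ // memv_span // -(nth_take 0 ltik) mem_nth // size_take size_tuple.
by case: ifP.
Qed.

Lemma dim_take k : (k <= degree L)%N -> \dim <<take k E>> = k.
Proof.
move=> lek; have freek : free (take k E).
  by apply: (@catl_free _ _ (drop k E)); rewrite cat_take_drop (basis_free basE).
by rewrite (eqP freek) size_takel // size_tuple.
Qed.

Lemma coord_take k u (i : 'I_(degree L)) : u \in <<take k E>>%VS -> (k <= i)%N ->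
  coord E i u = 0.
Proof.
move=> /(@coord_span _ _ _ (in_tuple (take k E))) -> leki.
rewrite linear_sum big1 // => j _; rewrite linearZ /=.
have ltjk : (j < k)%N by apply: leq_trans (ltn_ord j) _; rewrite size_take;
  case: ifP => //; lia.
have ltjn := ltn_trans (leq_trans ltjk leki) (ltn_ord i).
rewrite nth_take // (@coord_free _ _ _ E (Ordinal ltjn) i) ?(basis_free basE) //.
by rewrite -val_eqE /= ltn_eqF ?mulr0 // (leq_trans ltjk).
Qed.

(** An element shorter than [M ^ g i / C] has no nonzero coordinate of index [i] or more, so such
    elements span at most [i] dimensions; at length [C M ^ g i] the first [i + 1] generators are all
    allowed. *)
Lemma weighted_lambda i : is_order O -> (i < degree L)%N ->
  (M%:R : R) ^+ g i <= C * lambda R O i /\ lambda R O i <= C * M%:R ^+ g i.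
Proof.
move=> ordO ltin; have [l0 ltd minl] := lambdaP R ordO ltin; split.
  rewrite leNgt; apply/negP => lt_l; move: ltd; rewrite ltnNge => /negP; apply.
  rewrite -[leqRHS](dim_take (ltnW ltin)) dimvS //;
    apply: weighted_sub_take => x j [Ox xr] leij.
  apply: contrapT => /eqP nz; have := lower Ox nz; apply/negP; rewrite -ltNge.
  rewrite (le_lt_trans (ler_wpM2l (ltW C0) xr)) // (lt_le_trans lt_l) //.
  by rewrite ler_weXn2l // g_leq.
apply: minl; first by rewrite mulr_gt0 // exprn_gt0 // (lt_le_trans ltr01).
rewrite -[leqLHS](dim_take ltin) dimvS // weighted_take_sub // => j ltji.
by rewrite ler_wpM2l ?(ltW C0) // ler_weXn2l // g_leq.
Qed.

Lemma weighted_Qspan_ex k : (0 < k <= degree L)%N ->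
  exists2 r : R, 0 < r & Qspan (short O r) = <<take k E>>%VS.
Proof.
(* This radius allows the first [k + 1] generators, while a nonzero coordinate of index [j > k]
   would need [M ^ g j <= C ^ 2 M ^ g k < M ^ (g k + 1)]. *)
case: k => // k /= ltk; exists (C * M%:R ^+ g k).
  by rewrite mulr_gt0 // exprn_gt0 // (lt_le_trans ltr01).
apply/eqP; rewrite eqEsubv weighted_take_sub ?andbT => // [|j leji]; last first.
  by rewrite ler_wpM2l ?(ltW C0) // ler_weXn2l // g_leq.
apply: weighted_sub_take => x j [Ox xr] leij.
apply: contrapT => /eqP nz; have := lower Ox nz; apply/negP; rewrite -ltNge.
rewrite (le_lt_trans (ler_wpM2l (ltW C0) xr)) // mulrA -expr2.
have Mg : 0 < M%:R ^+ g k :> R by rewrite exprn_gt0 // (lt_le_trans ltr01).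
apply: (@lt_le_trans _ _ (M%:R * M%:R ^+ g k)); first by rewrite ltr_pM2r.
by rewrite -exprS ler_weXn2l // g_incr.
Qed.

(** For [k > 0], [k - 1] is the largest index of a nonzero coordinate among the elements of length
    at most [r]. That coordinate forces [M ^ g (k - 1) <= C r]; by [C ^ 2 < M] all earlier
    generators are short, and subtracting them leaves a multiple of the last vector. *)
Lemma weighted_Qspan (r : R) : exists2 k, (k <=
  degree L)%N & Qspan (short O r) = <<take k E>>%VS.
Proof.
pose P k := `[< (k <= degree L)%N /\ forall i, (i < k)%N ->
  exists x (j : 'I_(degree L)),
   [/\ short O r x, coord E j x != 0 & (i <= j)%N] >].
have exP : exists k, P k by exists 0%N; apply/asboolP.
have ubP k : P k -> (k <= degree L)%N by case/asboolP.
case: (ex_maxnP exP ubP) => k /asboolP[lek kP] maxk; exists k => //.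
have sub_k : (Qspan (short O r) <= <<take k E>>)%VS.
  apply: weighted_sub_take => x i xr leki; apply: contrapT => /eqP nz.
  have : P i.+1 by apply/asboolP; split=> // j; rewrite ltnS => leji; exists x, i.
  by move=> /maxk; rewrite ltnNge leki.
apply/eqP; rewrite eqEsubv sub_k /=.
case: k lek kP maxk sub_k => [|k] ltk kP maxk sub_k;
  first by rewrite take0 span_nil sub0v.
have [x [j [xr nz lekj]]] := kP k (leqnn _).
have ejk : j = Ordinal ltk.
  apply/val_inj/eqP; rewrite /= eqn_leq lekj andbT -ltnS.
  apply: (maxk j.+1); apply/asboolP; split=> // i; rewrite ltnS => leij.
  by exists x, j.
have sub_take : (<<take k E>> <= Qspan (short O r))%VS.
  apply: weighted_take_sub => [|i ltik]; first exact: ltnW.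
  have [Ox xr'] := xr; have := lower Ox nz; rewrite ejk /= => leMr.
  rewrite -(ler_pM2l C0) (le_trans _ (le_trans leMr (ler_wpM2l (ltW C0) xr'))) //.
  rewrite mulrA -expr2 (le_trans (ler_wpM2r _ (ltW CM))) ?exprn_ge0 //.
  by rewrite -exprS ler_weXn2l // g_incr.
suff Ek : E`_k \in Qspan (short O r).
  rewrite (take_nth 0) ?size_tuple // -cats1 span_cat subv_add sub_take span_seq1.
  exact: Ek.
have /subvP/(_ x (mem_Qspan xr)) := sub_k.
rewrite (take_nth 0) ?size_tuple // -cats1 span_cat span_seq1.
case/memv_addP => u ku [_ /vlineP[c ->] defx].
have c0 : c != 0.
  apply: contra nz => /eqP c0; rewrite defx c0 scale0r addr0 ejk.
  by rewrite (coord_take ku).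
have -> : E`_k = c^-1 *: (x - u) by rewrite defx addrC addKr scalerK.
by apply/memvZ/memvB; [exact: mem_Qspan | exact: (subvP sub_take)].
Qed.

End Weighted.

(** * The field generated by a root of 2 *)

(** [X^n - 2] is irreducible by Eisenstein's criterion at 2. *)
Lemma radical_field (n : nat) : (0 < n)%N ->
  exists (L : fieldExtType rat) (z : L),
    [/\ degree L = n, z ^+ n = 2 & <<1; z>>%VS = fullv].
Proof.
move=> n0; pose q : {poly int} := 'X^n - 2%:P.
have szq : size q = n.+1 by rewrite size_XnsubC.
have irr_q : irreducible_poly (map_poly (intr : int -> rat) q).
  apply/irreducible_rat_int; apply: (@eisenstein_crit 2) => //.
  - by rewrite szq; lia.
  - by rewrite (monicP (monicXnsubC _ n0)).
  - by rewrite coefB coefXn coefC eqxx (ltn_eqF n0) sub0r.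
  move=> i; rewrite szq /= => ltin;
    rewrite coefB coefXn coefC (ltn_eqF ltin) sub0r.
  by case: i {ltin}.
have [L dimL [z qz defL]] := irredp_FAdjoin irr_q.
exists L, z; split=> //.
  by rewrite /degree dimL size_map_poly_id0 ?szq // (monicP (monicXnsubC _ n0)).
move: qz; rewrite -map_poly_comp rmorphB /= map_polyXn map_polyC /=.
rewrite rootE hornerD hornerXn hornerN hornerC subr_eq0 => /eqP ->.
by rewrite scaler_int.
Qed.

Lemma adjoin_degree_le (L : fieldExtType rat) (F : {subfield L}) (x : L) (d :
  nat) :
  (0 < d)%N -> x ^+ d \in F -> (adjoin_degree F x <= d)%N.
Proof.
move=> d0 Fxd; rewrite -ltnS -size_minPoly -(size_XnsubC (x ^+ d) d0).
apply: dvdp_leq; first by rewrite monic_neq0 // monicXnsubC.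
apply: minPoly_dvdp; first by rewrite rpredB ?rpredX ?polyOverX ?polyOverC.
by rewrite rootE !hornerE subrr.
Qed.

Section RadicalTower.

Variables (T : seq nat) (L : fieldExtType rat) (z : L).
Hypothesis tT : is_tower_type T.
Hypothesis degL : degree L = tower_degree T.
Hypothesis zn : z ^+ tower_degree T = 2.
Hypothesis defL : <<1; z>>%VS = fullv.

(** The generator is an [n_1 ... n_v]-th root of 2. *)
Definition radical_subfield (v : nat) : {subfield L} :=
  <<1; z ^+ tower_degree (drop v T)>>%AS.

Local Notation F := radical_subfield.

(** [F v] has degree at most [n_1 ... n_v], and [L] has degree at most [n_(v+1) ... n_t] over it;
    the two bounds multiply to the degree of [L], so both are attained. *)
Lemma dim_radical_subfield v : (v <= size T)%N ->
  \dim (F v) = tower_degree (take v T).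
Proof.
move=> lev; have N0 := tower_degree_gt0 (is_tower_type_take v tT).
have D0 := tower_degree_gt0 (is_tower_type_drop v tT).
apply/eqP; rewrite eqn_leq; apply/andP; split.
  rewrite dim_Fadjoin dimv1 muln1 adjoin_degree_le // -exprM mulnC.
  by rewrite -tower_degree_take_drop zn rpred_nat.
rewrite -(leq_pmul2l D0) mulnC -tower_degree_take_drop -degL.
have -> : degree L = (adjoin_degree (F v) z * \dim (F v))%N.
  rewrite -dim_Fadjoin; congr (\dim _); apply/eqP.
  by rewrite eqEsubv subvf -defL adjoinSl ?sub1v.
by rewrite leq_mul2r adjoin_degree_le ?orbT // memv_adjoin.
Qed.

Lemma radical_subfield0 : F 0 = 1%AS.
Proof.
apply/val_inj/eqP; rewrite eq_sym eqEdim sub1v /=.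
by rewrite dim_radical_subfield // take0 tower_degree0 dimv1.
Qed.

Lemma radical_subfield_lt v : (v < size T)%N ->
  ((F v <= F v.+1)%VS && (F v != F v.+1)).
Proof.
move=> ltv; have [m1 tD] : (1 < nth 0%N T v)%N /\ is_tower_type (drop v.+1 T).
  by split; [exact: (allP tT _ (mem_nth _ ltv)) | exact: is_tower_type_drop].
apply/andP; split.
  rewrite sub_adjoin1v (drop_nth 0%N ltv) tower_degree_cons mulnC exprM rpredX //.
  exact: memv_adjoin.
apply/eqP => /(congr1 (fun K : {subfield L} => \dim K)).
rewrite !dim_radical_subfield ?(ltnW ltv) // tower_degree_takeS //.
have := tower_degree_gt0 (is_tower_type_take v tT); nia.
Qed.

Lemma radical_powers_free : basis_of {:L} [tuple z ^+ i | i < degree L].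
Proof.
rewrite basisEfree size_tuple leqnn subvf !andbT; apply/freeP => k sum0 i.
(* A linear relation between the powers is a polynomial that vanishes at [z], of degree less than
   that of [z]. *)
pose q := \poly_(j < degree L) (if insub j is Some j' then k j' else 0).
have szq : (size q <= degree L)%N by exact: size_poly.
have deg1 : adjoin_degree 1 z = degree L
  by rewrite adjoin_degreeE defL dimv1 divn1.
have : map_poly (in_alg L) q == 0.
  rewrite -(@root_small_adjoin_poly _ _ 1%AS z) ?alg_polyOver //; last first.
    by rewrite deg1 size_map_poly.
  apply/rootP; rewrite (@horner_coef_wide _ (degree L)) ?size_map_poly //
    -[RHS]sum0.
  apply: eq_bigr => j _; rewrite coef_map /= coef_poly ltn_ord valK.
  by rewrite nth_mktuple mulr_algl.
rewrite map_poly_eq0 => /eqP/polyP/(_ i).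
by rewrite coef_poly ltn_ord valK coef0.
Qed.

End RadicalTower.

Section RadicalOrder.

Variables (T : seq nat) (L : fieldExtType rat) (z : L).
Hypothesis tT : is_tower_type T.
Hypothesis degL : degree L = tower_degree T.
Hypothesis zn : z ^+ tower_degree T = 2.
Hypothesis defL : <<1; z>>%VS = fullv.

Lemma radical_basis_ex : exists E : (degree L).-tuple L,
  basis_of {:L} E /\
  forall a, (a < tower_degree T)%N -> E`_(radix_rev T a) = z ^+ a.
Proof.
have /choice[s sP] : forall k : 'I_(degree L), exists a,
    (a < tower_degree T)%N /\ radix_rev T a = k.
  move=> k; have ltk : (k < tower_degree T)%N by rewrite -degL.
  by have [a lta eqa] := radix_rev_surj tT ltk; exists a.
pose E := [tuple z ^+ s k | k < degree L]; exists E.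
have EP a : (a < tower_degree T)%N -> E`_(radix_rev T a) = z ^+ a.
  move=> lta; have ltr : (radix_rev T a < degree L)%N
    by rewrite degL radix_rev_lt.
  rewrite -[radix_rev T a]/(nat_of_ord (Ordinal ltr)) nth_mktuple; congr (_ ^+ _).
  have [lts eqs] := sP (Ordinal ltr); exact: radix_rev_inj eqs.
split=> //; rewrite basisEdim size_tuple leqnn andbT.
rewrite -(span_basis (radical_powers_free defL)).
apply/span_subvP => x xp; have [a] := elimT (nthP 0) xp.
rewrite size_tuple => lta <-;
  rewrite -[a]/(nat_of_ord (Ordinal lta)) nth_mktuple /=.
rewrite -EP -?degL //; apply/memv_span/mem_nth.
by rewrite size_tuple [ltnRHS]degL radix_rev_lt // -degL.
Qed.

Variable E : (degree L).-tuple L.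
Hypothesis EP : forall a, (a < tower_degree T)%N -> E`_(radix_rev T a) = z ^+ a.

Local Notation F := (radical_subfield T z).

(** Vectors of index below [n_1 ... n_v] lie in [F v], and the one of index [n_1 ... n_(v-1)]
    generates it. For [v = 0] the last hypothesis is vacuous and both sides are the rationals, even
    when [k = 0]. *)
Lemma adjoin_take_radical k v : (v <= size T)%N ->
  (k <= tower_degree (take v T))%N ->
  (forall v', v = v'.+1 -> (tower_degree (take v' T) < k)%N) ->
  agenv <<take k E>> = F v.
Proof.
move=> lev lek ltk; apply/eqP; rewrite eqEsubv; apply/andP; split.
  rewrite -(subfield_closed (F v)) agenvS //; apply/span_subvP => x xk.
  have [m] := elimT (nthP 0) xk; rewrite size_take size_tuple => ltm <-.
  have ltmk : (m < k)%N by move: ltm; case: ifP => // /negbT; lia.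
  have ltmN : (m < tower_degree T)%N by rewrite -degL; move: ltm;
    case: ifP => //; lia.
  have [a lta eqm] := radix_rev_surj tT ltmN.
  rewrite nth_take // -eqm EP //.
  have /dvdnP[q ->] : (tower_degree (drop v T) %| a)%N.
    by apply: radix_rev_dvd => //; rewrite eqm (leq_trans ltmk).
  by rewrite mulnC exprM rpredX // memv_adjoin.
have -> : agenv <<take k E>> = (<< <<take k E>>%VS >>%AS : {vspace L}) by [].
case: v lev ltk lek => [|v] ltv ltk lek;
  first by rewrite radical_subfield0 // sub1v.
rewrite sub_adjoin1v -EP ?ltn_tower_degree_drop //.
rewrite radix_rev_gen //; apply: (subvP (sub_agenv _)).
have ltNk := ltk v erefl.
apply: memv_span; rewrite -(nth_take 0 ltNk) mem_nth // size_take size_tuple.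
case: ifP => // _; apply: leq_trans ltNk _; apply: leq_trans lek _.
rewrite [leqRHS]degL -[in leqRHS](take_oversize (leqnn (size T))).
exact: leq_tower_degree_take.
Qed.

Lemma adjoin_take_radical_ex k : (k <= tower_degree T)%N ->
  exists2 v, (v <= size T)%N & agenv <<take k E>> = F v.
Proof.
move=> lek; have exv : exists v, (k <= tower_degree (take v T))%N.
  by exists (size T); rewrite take_size.
case: (ex_minnP exv) => v lev minv.
have le_v : (v <= size T)%N by apply: minv; rewrite take_size.
exists v => //; apply: adjoin_take_radical => // v' eqv; rewrite ltnNge.
by apply/negP => /minv; rewrite eqv ltnn.
Qed.

Lemma radical_adjoin_take_ex v : (v <= size T)%N ->
  exists2 k, (0 < k <= tower_degree T)%N & agenv <<take k E>> = F v.
Proof.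
move=> lev.
have le_full w : (tower_degree (take w T) <= tower_degree T)%N.
  rewrite (tower_degree_take_drop w T) leq_pmulr //.
  by rewrite tower_degree_gt0 // is_tower_type_drop.
case: v lev => [|v] ltv.
  exists 1%N; first by rewrite tower_degree_gt0.
  by apply: adjoin_take_radical => //; rewrite take0 tower_degree0.
have lt : (tower_degree (take v T) < tower_degree (take v.+1 T))%N.
  have [m1 N0] : (1 < nth 0%N T v)%N /\ (0 < tower_degree (take v T))%N.
    split; first exact: (allP tT _ (mem_nth _ ltv)).
    by rewrite tower_degree_gt0 // is_tower_type_take.
  by rewrite tower_degree_takeS //; nia.
exists (tower_degree (take v T)).+1; first by rewrite (leq_trans lt) ?le_full.
by apply: adjoin_take_radical => // v' [<-].
Qed.

(** The hypotheses reduce the fields generated by short elements to those generated by initial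
    segments of [E], which are the [F v]. The list starts at [F 1] because [F 0] is the base
    field. *)
Lemma radical_tower_type (R : realType) (O : {pred L}) :
  (forall r : R, exists2 k, (k <=
    tower_degree T)%N & Qspan (short O r) = <<take k E>>%VS) ->
  (forall k, (0 < k <= tower_degree T)%N ->
     exists2 r : R, 0 < r & Qspan (short O r) = <<take k E>>%VS) ->
  has_tower_type R O T.
Proof.
move=> spanO exO; exists [seq F v | v <- iota 1 (size T)].
have Ks_nth v : (v <= size T)%N ->
    nth 1%AS (1%AS :: [seq F v | v <- iota 1 (size T)]) v = F v.
  case: v => [|v] lev /=; first by rewrite radical_subfield0.
  by rewrite (nth_map 0%N) ?size_iota // nth_iota.
have Ks_nthS v : (v < size T)%N ->
  nth 1%AS [seq F v | v <- iota 1 (size T)] v = F v.+1.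
  exact: (Ks_nth v.+1).
split.
- apply/(pathP 1%AS) => v; rewrite size_map size_iota => ltv.
  rewrite Ks_nthS // Ks_nth ?(ltnW ltv) //.
  exact: (radical_subfield_lt tT degL zn defL ltv).
- move=> K; split.
    move=> /(nthP 1%AS)[v]; rewrite /= size_map size_iota ltnS => lev.
    rewrite Ks_nth // => <-; have [k lek eqF] := radical_adjoin_take_ex lev.
    have [r r0 eqk] := exO k lek; exists r => //.
    by apply: val_inj; rewrite /= eqk -eqF.
  case=> r _ ->; have [k lek eqk] := spanO r.
  have [v lev eqF] := adjoin_take_radical_ex lek.
  have -> : Qadjoin (short O r) = F v by apply: val_inj; rewrite /= eqk eqF.
  by rewrite -Ks_nth // mem_nth //= size_map size_iota.
- apply: (@eq_from_nth _ 0%N); first by rewrite size_pairmap size_map size_iota.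
  move=> v ltv; rewrite (nth_pairmap 1%AS) ?size_map ?size_iota //.
  rewrite Ks_nthS // Ks_nth ?(ltnW ltv) //.
  rewrite !(dim_radical_subfield tT degL zn) ?(ltnW ltv) // tower_degree_takeS //
    mulKn //.
  by rewrite tower_degree_gt0 // is_tower_type_take.
Qed.

Variable u : nat.
Hypothesis leu : (u <= size T)%N.

(** The first term makes the weight strictly increasing; the second gains one when a carry leaves
    the first [u] digits. *)
Definition carry_weight (m : nat) : nat := (m + m %/ tower_degree (take u T))%N.

Lemma carry_weight_incr m k : (m < k)%N -> (carry_weight m < carry_weight k)%N.
Proof. by move=> ltmk;
  rewrite /carry_weight -addSn leq_add // leq_div2r // ltnW. Qed.

(** Both terms of the weight are subadditive: by [radix_rev_div], the second is the index for the
    shorter type [drop u T]. *)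
Lemma carry_weight_mul (i j : 'I_(degree L)) : exists (c : 'I_(degree L)) (m :
  nat),
  E`_i * E`_j = E`_c *+ m /\ (carry_weight c <=
    carry_weight i + carry_weight j)%N.
Proof.
have [a lta eqi] : exists2 a, (a < tower_degree T)%N & radix_rev T a = i.
  by apply: radix_rev_surj; rewrite // -degL.
have [b ltb eqj] : exists2 b, (b < tower_degree T)%N & radix_rev T b = j.
  by apply: radix_rev_surj; rewrite // -degL.
have N0 := tower_degree_gt0 tT.
have ltab : ((a + b) %% tower_degree T < tower_degree T)%N by rewrite ltn_pmod.
have ltc : (radix_rev T ((a + b) %% tower_degree T) < degree L)%N.
  by rewrite degL radix_rev_lt.
exists (Ordinal ltc), (2 ^ ((a + b) %/ tower_degree T))%N; split.
  rewrite -eqi -eqj /= !EP // -exprD {1}(divn_eq (a + b) (tower_degree T)).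
  by rewrite exprD mulnC exprM zn -natrX mulr_natl.
rewrite /carry_weight /= -eqi -eqj addnACA leq_add ?radix_rev_modD //.
rewrite !radix_rev_div // modn_dvdm;
  last by rewrite (tower_degree_take_drop u T) dvdn_mull.
rewrite -modnDm radix_rev_modD ?is_tower_type_drop //;
  by rewrite ltn_pmod // tower_degree_gt0 // is_tower_type_drop.
Qed.

End RadicalOrder.

(** * The lower bound and the equivalence *)

Lemma overflow_unbounded (R : realType) (T : seq nat) (u i j : nat) (c : R) :
  is_tower_type T -> (u <= size T)%N -> (i + j < tower_degree T)%N ->
  (tower_degree (take u T) <=
    i %% tower_degree (take u T) + j %% tower_degree (take u T))%N ->
  0 < c -> exists (L : fieldExtType rat) (O : {pred L}),
    in_S R T O /\ c * lambda R O i * lambda R O j < lambda R O (i + j).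
Proof.
move=> tT leu ltij over c0; have N0 := tower_degree_gt0 (is_tower_type_take u tT).
have [L [z [degL zn defL]]] := radical_field (tower_degree_gt0 tT).
have [E [basE EP]] := radical_basis_ex tT degL defL.
pose g := carry_weight T u.
(* The carry out of the first [u] digits raises the quotient by one. *)
have gij : g (i + j)%N = (g i + g j).+1.
  by rewrite /g /carry_weight divnD // over addn1 addnS addnACA.
have [C C0 bounds] := weighted_bounds R g basE.
(* The term [C ^ 2] separates consecutive weights; [c * C ^ 3] serves the final comparison. *)
pose M := Num.bound (C ^+ 2 + c * C ^+ 3).
have ltM : C ^+ 2 + c * C ^+ 3 < M%:R.
  by rewrite archi_boundP // addr_ge0 ?mulr_ge0 ?exprn_ge0 // ltW.
have cC : 0 < c * C ^+ 3 by rewrite mulr_gt0 ?exprn_gt0.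
have CM : C ^+ 2 < M%:R by apply: lt_trans ltM; rewrite ltrDl.
have M0 : (0 < M)%N by rewrite -(ltr_nat R) (le_lt_trans _ CM) // sqr_ge0.
have [upper lower] := bounds M M0.
have g_incr : forall m k, (m < k)%N -> (g m < g k)%N by move=> m k;
  exact: carry_weight_incr.
exists L, (intspan (weighted E g M)).
have ordO : is_order (intspan (weighted E g M)).
  apply: weighted_order => //; last exact: (carry_weight_mul tT degL zn EP leu).
  - by have := EP 0%N (tower_degree_gt0 tT); rewrite radix_rev0 expr0.
  - by rewrite /g /carry_weight div0n.
split.
  split=> //; apply: (radical_tower_type tT degL zn defL EP) => [r|k lek].
    have [k lek ->] := weighted_Qspan basE g_incr C0 M0 CM upper lower r.
    by exists k => //; rewrite -degL.
  by apply: (weighted_Qspan_ex basE g_incr C0 M0 CM upper lower); rewrite degL.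
have bnd k : (k < tower_degree T)%N ->
   M%:R ^+ g k <= C * lambda R (intspan (weighted E g M)) k /\
   lambda R (intspan (weighted E g M)) k <= C * M%:R ^+ g k.
  by move=> ltk; apply: weighted_lambda => //; rewrite degL.
have lti : (i < tower_degree T)%N := leq_ltn_trans (leq_addr j i) ltij.
have ltj : (j < tower_degree T)%N := leq_ltn_trans (leq_addl i j) ltij.
have [_ ui] := bnd i lti; have [_ uj] := bnd j ltj.
have [lij _] := bnd (i + j)%N ltij.
have l0 k : (k < tower_degree T)%N -> 0 < lambda R (intspan (weighted E g M)) k.
  by rewrite -degL => /(lambdaP R ordO)[].
have [li0 lj0] := (l0 i lti, l0 j ltj).
(* The chain is [C c lambda_i lambda_j <= c C^3 M^(g i + g j) < M^(g i + g j + 1) = M^(g (i + j)) <=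
   C lambda_(i+j)]. *)
rewrite -(ltr_pM2l C0) (lt_le_trans _ lij) // gij exprS exprD.
have MM : 0 < M%:R ^+ g i * M%:R ^+ g j :> R
  by rewrite mulr_gt0 ?exprn_gt0 ?ltr0n.
apply: (@le_lt_trans _ _ (c * C ^+ 3 * (M%:R ^+ g i * M%:R ^+ g j))); last first.
  by rewrite ltr_pM2r // (lt_trans _ ltM) // ltrDr exprn_gt0.
have -> : c * C ^+ 3 * (M%:R ^+ g i * M%:R ^+ g j) =
    C * c * ((C * M%:R ^+ g i) * (C * M%:R ^+ g j)) by ring.
by rewrite -(mulrA c) (mulrA C) ler_pM2l ?mulr_gt0 // ler_pM // ltW.
Qed.

Theorem theorem1p15 (R : realType) (T : seq nat) :
  is_tower_type T ->
  (tower_degree T < 8)%N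
  \/ (tower_degree T = 8%N /\ T <> [:: 8%N])
  \/ prime (tower_degree T)
  \/ (exists p t : nat, prime p /\ T = nseq t p)
  \/ (exists p : nat, prime p /\ T = [:: 2%N; p])
  \/ (exists p : nat, prime p /\ T = [:: 3%N; p]) ->
  forall i j : nat, (i + j < tower_degree T)%N ->
    (exists c : R, 0 < c /\
       forall (L : fieldExtType rat) (O : {pred L}), in_S R T O ->
         lambda R O (i + j) <= c * lambda R O i * lambda R O j)
    <-> no_overflow T i j.
Proof.
move=> tT admT i j ltij; split=> [[c [c0 cP]]|noov].
  apply: mod_no_overflow => // u leu; rewrite ltnNge; apply/negP => over.
  have [L [O [SO]]] := overflow_unbounded tT leu ltij over c0.
  by rewrite ltNge cP.
exists (Num.sqrt (tower_degree T)%:R ^+ 3); split.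
  by rewrite exprn_gt0 // sqrtr_gt0 ltr0n tower_degree_gt0.
by move=> L O SO; apply: lambda_le_mul.
Qed.
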